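(* Let $n$ be a positive integer. For every $R>0$ there is a constant $C(R)$, depending only on $R$ and the dimension $n$, such that the following holds. Let $K,L\subset\mathbb{R}^n$ be convex bodies such that $K_2=K+2B^n$ and $L_2=L+2B^n$ are both contained in some ball of radius $R$. Then for every $i\in\{0,\dots,n-1\}$, $$ d_{bL}(\Lambda_i(K,\cdot),\Lambda_i(L,\cdot))\le C(R)\, d_H(K,L)^{1/2}, $$ where $\Lambda_i(K,\cdot)$ denotes the $i$th support measure of $K$, $d_{bL}$ the bounded Lipschitz metric and $d_H$ the Hausdorff metric.
   Context: A convex body in $\mathbb{R}^n$ is a nonempty compact convex subset; $B^n$ is the closed unit ball and $|\cdot|$ the Euclidean norm. For $\rho\ge 0$, $K_\rho:=K+\rho B^n$ is the parallel body of $K$. The Hausdorff distance is $d_H(K,L)=\min\{\rho\ge0: K\subset L_\rho,\ L\subset K_\rho\}$. For a convex body $K$ and $x\in\mathbb{R}^n$, $p_K(x)$ is the unique point of $K$ nearest to $x$, $d_K(x)=|x-p_K(x)|$, and for $x\notin K$, $u_K(x)=(x-p_K(x))/d_K(x)\in\mathbb{S}^{n-1}$. For $\rho>0$, $K^\rho:=K_\rho\setminus K$. Let $\Sigma^n:=\mathbb{R}^n\times\mathbb{S}^{n-1}$ with the Euclidean metric induced from $\mathbb{R}^n\times\mathbb{R}^n$. For Borel $\eta\subset\Sigma^n$ put $$\mu_{K,\rho}(\eta):=\mathcal{H}^n(\{x\in K^\rho:(p_K(x),u_K(x))\in\eta\}),$$ where $\mathcal{H}^n$ is $n$-dimensional Hausdorff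 measure. The support measures $\Lambda_0(K,\cdot),\dots,\Lambda_{n-1}(K,\cdot)$ are the finite Borel measures on $\Sigma^n$ uniquely determined by the polynomial expansion $$\mu_{K,\rho}(\eta)=\sum_{i=0}^{n-1}\rho^{n-i}\kappa_{n-i}\Lambda_i(K,\eta)\quad\text{for all }\rho>0\text{ and all Borel }\eta\subset\Sigma^n,$$ where $\kappa_j$ is the $j$-dimensional volume of $B^j$ (the existence of this expansion, the local Steiner formula, is a known fact). For finite Borel measures $\mu,\nu$ on $\Sigma^n$, $$d_{bL}(\mu,\nu):=\sup\left\{\left|\int f\,d\mu-\int f\,d\nu\right|: f:\Sigma^n\to\mathbb{R},\ \|f\|_L\le1,\ \|f\|_\infty\le1\right\},$$ where $\|f\|_L=\sup_{a\ne b}|f(a)-f(b)|/|a-b|$ and $\|f\|_\infty=\sup_a|f(a)|$. *)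

(* Defs.v *)
(* R^n is 'rV[R]_n.  The library norm `|x| on row vectors is the sup norm, hence
   the separate Euclidean norm below; both induce the topology of 'rV[R]_n. *)
From HB Require Import structures.
From mathcomp Require Import all_boot all_order all_algebra.
From mathcomp Require Import all_classical all_reals all_analysis.
Import Order.TTheory GRing.Theory Num.Theory.
Import numFieldNormedType.Exports.

Set Implicit Arguments.
Unset Strict Implicit.
Unset Printing Implicit Defensive.

Local Open Scope classical_set_scope.
Local Open Scope ring_scope.

Section euclidean_space.
Context {R : realType} {n : nat}.
Implicit Types (x c : 'rV[R]_n) (K L : set 'rV[R]_n).

Definition enorm x : R := Num.sqrt (\sum_(i < n) x ord0 i ^+ 2).

Definition eball c (r : R) : set 'rV[R]_n := [set x | enorm (x - c) <= r].

Definition convex_body K : Prop :=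
  [/\ K !=set0, compact K & convex_set (K : set (convex_lmodType 'rV[R]_n))].

(* K + rho B^n *)
Definition parallel K (rho : R) : set 'rV[R]_n :=
  [set x + rho *: b | x in K & b in eball 0 1].

(* For convex bodies the infimum is a minimum. *)
Definition hausdorff_dist K L : R :=
  inf [set rho | [/\ 0 <= rho, K `<=` parallel L rho & L `<=` parallel K rho]].

(* The default value 0 is never used when K is a convex body. *)
Definition metric_proj K x : 'rV[R]_n :=
  xget 0 [set y | K y /\ forall z, K z -> enorm (x - y) <= enorm (x - z)].

Definition body_dist K x : R := enorm (x - metric_proj K x).

Definition outer_dir K x : 'rV[R]_n :=
  (body_dist K x)^-1 *: (x - metric_proj K x).

End euclidean_space.

Section volume.
Context {R : realType}.

(* n-fold product of one-dimensional Lebesgue measure, as an iterated integral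
   over the first coordinate. *)
Fixpoint volume (n : nat) : set 'rV[R]_n -> \bar R :=
  match n with
  | 0 => fun A => ((0 \in A)%:R)%:E
  | n'.+1 => fun A =>
      (\int[lebesgue_measure]_t
         volume [set y : 'rV[R]_n' | A (row_mx (t%:M : 'rV[R]_1) y)])%E
  end.

Definition kappa (n : nat) : R := fine (volume (eball (0 : 'rV[R]_n) 1)).

End volume.

Section hausdorff_measure.
Context {R : realType} {n : nat}.
Implicit Types A : set 'rV[R]_n.
Local Open Scope ereal_scope.

(* 0 is added to the set so that the empty set has diameter 0. *)
Definition diam A : \bar R :=
  ereal_sup (0 |` [set (enorm (x - y))%:E | x in A & y in A]).

Definition hausdorff_content (delta : R) A : \bar R :=
  ereal_inf [set \sum_(k <oo) (kappa n / 2 ^+ n)%R%:E * diam (U k) ^+ n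
            | U in [set U : (set 'rV[R]_n)^nat |
                (forall k, diam (U k) <= delta%:E) /\ A `<=` \bigcup_k U k]].

(* H^n on R^n, with the usual normalization (the diameter-2 ball has weight
   kappa n).  For n = 0 the power diam (U k) ^+ 0 also counts empty sets; only
   n > 0 is used. *)
Definition hausdorff_measure A : \bar R :=
  ereal_sup [set hausdorff_content delta A | delta in [set d : R | (0 < d)%R]].

End hausdorff_measure.

Section normal_bundle.
Context (R : realType) (n : nat).

(* Sigma R n is R^(n+1) times the unit sphere of R^(n+1): the ambient dimension
   is written n.+1, which makes it positive and the sphere inhabited. *)
Definition Sigma_set : set ('rV[R]_n.+1 * 'rV[R]_n.+1) :=
  [set z | enorm z.2 = 1].

Definition Sigma : Type := set_type Sigma_set.

HB.instance Definition _ := Topological.copy Sigma (set_type Sigma_set).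

Fact Sigma_point_subproof :
  (0 : 'rV[R]_n.+1, delta_mx 0 0 : 'rV[R]_n.+1) \in Sigma_set.
Proof.
rewrite inE /Sigma_set /= /enorm (bigD1 ord0)//= big1 => [|i /negbTE i0].
  by rewrite !mxE !eqxx expr1n addr0 sqrtr1.
by rewrite !mxE i0 andbF expr0n.
Qed.

HB.instance Definition _ :=
  isPointed.Build Sigma
    (exist (fun z => z \in Sigma_set) _ Sigma_point_subproof).

End normal_bundle.

(* Sigma with its Borel sigma-algebra. *)
Notation SigmaB R n := (g_sigma_algebraType (@open (Sigma R n))).

Section bounded_lipschitz.
Context {R : realType} {n : nat}.
Implicit Types (a b : SigmaB R n) (f : SigmaB R n -> R).

Definition sdist a b : R :=
  Num.sqrt (enorm ((val a).1 - (val b).1) ^+ 2 +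
            enorm ((val a).2 - (val b).2) ^+ 2).

Local Open Scope ereal_scope.

Definition lip_norm f : \bar R :=
  ereal_sup [set e | exists a b,
                       a <> b /\ e = (`|f a - f b| / sdist a b)%R%:E].

Definition sup_norm f : \bar R := ereal_sup (range (fun a => (`|f a|%R)%:E)).

Definition dbL (mu nu : {finite_measure set (SigmaB R n) -> \bar R}) : \bar R :=
  ereal_sup [set (`| \int[mu]_z f z - \int[nu]_z f z |%R)%:E
            | f in [set f | lip_norm f <= 1 /\ sup_norm f <= 1]].

End bounded_lipschitz.

Section support_measures.
Context {R : realType} {n : nat}.
Implicit Types (K : set 'rV[R]_n.+1).

(* The preimage of eta under (p_K, u_K) in K_rho \ K. *)
Definition local_parallel K (rho : R) (eta : set (SigmaB R n)) :
    set 'rV[R]_n.+1 :=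
  [set x | (parallel K rho `\` K) x /\
           (val @` eta) (metric_proj K x, outer_dir K x)].

Definition mu_parallel K (rho : R) (eta : set (SigmaB R n)) : \bar R :=
  hausdorff_measure (local_parallel K rho eta).

(* Lam i is the i-th support measure of K, in dimension n.+1: by comparison of
   coefficients in rho, the local Steiner formula determines all Lam i. *)
Definition support_measures K
    (Lam : 'I_n.+1 -> {finite_measure set (SigmaB R n) -> \bar R}) : Prop :=
  forall (rho : R) (eta : set (SigmaB R n)), 0 < rho -> measurable eta ->
    mu_parallel K rho eta =
    (\sum_(i < n.+1)
       (rho ^+ (n.+1 - i) * kappa (n.+1 - i))%R%:E * Lam i eta)%E.

End support_measures.

(* Main.v *)
(* The support measures of K are recovered from the measures of the shells
   {1 < d_K <= b} with 1 < b <= 2, by inverting a Vandermonde system in b.  Away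
   from K the map x |-> (p_K x, u_K x) is stable: if K and L are at Hausdorff
   distance at most s^2, obtuseness of the angle at the projection gives
   |p_K - p_L| <= 2 s, hence |u_K - u_L| <= 4 s where d_K, d_L >= 1, whereas near
   K the direction u_K could not be controlled at this rate.  The two shells
   differ by thin shells of width s^2, whose measure is O(s^2) by the Steiner
   formula, so comparing the superlevel sets of a bounded Lipschitz f at levels
   spaced by 8 s yields the bound O(s) for the integrals of f.

   Only monotonicity, subadditivity and additivity on separated sets of the
   Hausdorff outer measure are needed: the measure of a shell is
   a difference of Steiner polynomials because these are continuous in the
   radius. *)
Require Import Defs.
From mathcomp Require Import all_boot all_order all_algebra.
From mathcomp Require Import all_classical all_reals all_analysis.
From mathcomp Require Import ring lra.
Import Order.TTheory GRing.Theory Num.Theory.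
Import numFieldNormedType.Exports.
Local Open Scope classical_set_scope.
Local Open Scope ring_scope.
Set Implicit Arguments.
Unset Strict Implicit.
Unset Printing Implicit Defensive.

(** * Euclidean geometry and metric projections *)

Section euclidean.
Context {R : realType} {n : nat}.
Implicit Types (x y z : 'rV[R]_n).

Definition dotp x y : R := \sum_i x ord0 i * y ord0 i.

Lemma dotpC x y : dotp x y = dotp y x.
Proof. by apply: eq_bigr => i _; rewrite mulrC. Qed.

Lemma dotpDl x y z : dotp (x + y) z = dotp x z + dotp y z.
Proof. by rewrite -big_split; apply: eq_bigr => i _; rewrite mxE mulrDl. Qed.

Lemma dotpZl a x y : dotp (a *: x) y = a * dotp x y.
Proof. by rewrite mulr_sumr; apply: eq_bigr => i _; rewrite mxE mulrA. Qed.

Lemma dotpNl x y : dotp (- x) y = - dotp x y.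
Proof. by rewrite -scaleN1r dotpZl mulN1r. Qed.

Lemma dotpBl x y z : dotp (x - y) z = dotp x z - dotp y z.
Proof. by rewrite dotpDl dotpNl. Qed.

Lemma dotpBr x y z : dotp z (x - y) = dotp z x - dotp z y.
Proof. by rewrite dotpC dotpBl !(dotpC z). Qed.

Lemma dotpZr a x y : dotp x (a *: y) = a * dotp x y.
Proof. by rewrite dotpC dotpZl dotpC. Qed.

Lemma dotp_ge0 x : 0 <= dotp x x.
Proof. by apply: sumr_ge0 => i _; rewrite -expr2 sqr_ge0. Qed.

Lemma enorm_ge0 x : 0 <= enorm x. Proof. exact: sqrtr_ge0. Qed.

Lemma enorm_sqr x : enorm x ^+ 2 = dotp x x.
Proof.
rewrite /enorm sqr_sqrtr; first by apply: eq_bigr => i _; rewrite expr2.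
by apply: sumr_ge0 => i _; rewrite sqr_ge0.
Qed.

Lemma enorm_dotp x : enorm x = Num.sqrt (dotp x x).
Proof. by rewrite -enorm_sqr sqrtr_sqr ger0_norm// enorm_ge0. Qed.

Lemma enormZ a x : enorm (a *: x) = `|a| * enorm x.
Proof.
by rewrite !enorm_dotp dotpZl dotpZr mulrA -expr2 sqrtrM ?sqr_ge0// sqrtr_sqr.
Qed.

Lemma enormN x : enorm (- x) = enorm x.
Proof. by rewrite -scaleN1r enormZ normrN1 mul1r. Qed.

Lemma enormC x y : enorm (x - y) = enorm (y - x).
Proof. by rewrite -opprB enormN. Qed.

Lemma enorm0 : enorm (0 : 'rV[R]_n) = 0.
Proof. by rewrite -(scale0r 0) enormZ normr0 mul0r. Qed.

Lemma coord_le_enorm x i : `|x ord0 i| <= enorm x.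
Proof.
rewrite -(@ler_pXn2r _ 2)// ?nnegrE ?enorm_ge0//.
rewrite -normrX ger0_norm ?sqr_ge0// enorm_sqr.
rewrite /dotp (bigD1 i)//= -expr2 lerDl.
by apply: sumr_ge0 => j _; rewrite -expr2 sqr_ge0.
Qed.

Lemma enorm_eq0 x : enorm x = 0 -> x = 0.
Proof.
move=> x0; apply/rowP => i; rewrite mxE.
by apply/eqP; rewrite -normr_le0 -x0 coord_le_enorm.
Qed.

(** Cauchy-Schwarz: expand the square of [enorm y *: x - enorm x *: y] and divide by the product of
    the two norms. *)
Lemma dotp_le x y : dotp x y <= enorm x * enorm y.
Proof.
have [/enorm_eq0->|x0] := eqVneq (enorm x) 0.
  by rewrite enorm0 mul0r -(scale0r 0) dotpZl mul0r.
have [/enorm_eq0->|y0] := eqVneq (enorm y) 0.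
  by rewrite enorm0 mulr0 -(scale0r 0) dotpZr mul0r.
have xy_gt0 : 0 < enorm x * enorm y.
  by rewrite mulr_gt0// lt_neqAle eq_sym enorm_ge0 ?x0 ?y0.
have := dotp_ge0 (enorm y *: x - enorm x *: y).
rewrite !dotpBl !dotpBr !dotpZl !dotpZr -!enorm_sqr (dotpC y x).
have -> : enorm y * (enorm y * enorm x ^+ 2) - enorm y * (enorm x * dotp x y) -
  (enorm x * (enorm y * dotp x y) - enorm x * (enorm x * enorm y ^+ 2)) =
  (enorm x * enorm y) * (2 * (enorm x * enorm y - dotp x y)) by ring.
by rewrite !pmulr_rge0// subr_ge0.
Qed.

Lemma enormD x y : enorm (x + y) <= enorm x + enorm y.
Proof.
rewrite -(@ler_pXn2r _ 2)// ?nnegrE ?addr_ge0 ?enorm_ge0//.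
rewrite sqrrD !enorm_sqr dotpDl !(dotpC _ (x + y)) !dotpDl.
have := dotp_le x y; rewrite (dotpC y x); lra.
Qed.

Lemma enorm_sqrB x y :
  enorm (x - y) ^+ 2 = enorm x ^+ 2 - 2 * dotp x y + enorm y ^+ 2.
Proof. by rewrite !enorm_sqr !dotpBl !dotpBr (dotpC y x); ring. Qed.

Lemma enorm_triangle z x y : enorm (x - y) <= enorm (x - z) + enorm (z - y).
Proof. by rewrite (le_trans _ (enormD _ _))// subrKA. Qed.

Lemma coord_le_norm x i : `|x ord0 i| <= `|x|.
Proof.
rewrite [X in _ <= X]mx_normrE.
exact: (le_bigmax (0 : R) (fun k => `|x k.1 k.2|) (ord0, i)).
Qed.

Lemma enorm_le_coord x d : 0 <= d -> (forall i, `|x ord0 i| <= d) ->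
  enorm x <= n%:R * d.
Proof.
move=> d0 xd; rewrite -(@ler_pXn2r _ 2)// ?nnegrE ?mulr_ge0 ?enorm_ge0//.
rewrite enorm_sqr exprMn (@le_trans _ _ (\sum_(i < n) d ^+ 2))//.
  apply: ler_sum => i _; rewrite -expr2 -[leLHS]ger0_norm ?sqr_ge0// normrX.
  by rewrite ler_pXn2r ?nnegrE.
rewrite sumr_const card_ord -[leLHS]mulr_natl ler_wpM2r ?sqr_ge0//.
rewrite -natrX ler_nat.
by case: (n) => // m; rewrite expnS leq_pmulr// expn1.
Qed.

Lemma enorm_le_norm x : enorm x <= n%:R * `|x|.
Proof. by apply: enorm_le_coord => // i; exact: coord_le_norm. Qed.

Lemma enorm_continuous : continuous (fun x => enorm x).
Proof.
move=> x; apply: (@cvgrPdist_le _ _ _ _ (nbhs_filter x) _ _).2 => e e0.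
(* Balls here are those of the sup norm, which controls [enorm] up to the factor [n]; the successor
   keeps the radius meaningful when [n = 0]. *)
apply/nbhs_ballP; exists (e / n.+1%:R) => /=; first by rewrite divr_gt0.
move=> y; rewrite mx_norm_ball /= => xy.
have le_e : enorm (x - y) <= e.
  apply: (le_trans (enorm_le_norm _)).
  rewrite (@le_trans _ _ (n.+1%:R * `|x - y|))//.
    by rewrite ler_wpM2r// ler_nat.
  by rewrite mulrC -ler_pdivlMr// ltW.
rewrite (le_trans _ le_e)// ler_norml.
have := enormD (x - y) y; have := enormD (y - x) x.
by rewrite !subrK (enormC y x) => *; apply/andP; split; lra.
Qed.

End euclidean.

(** * Nearest points and outer directions of convex bodies *)

Section projection.
Context {R : realType} {n : nat}.
Implicit Types (x y z : 'rV[R]_n) (K L : set 'rV[R]_n).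

(** The continuous distance to [x] attains its minimum on the compact set [K], so the default of
    [xget] is never returned. *)
Lemma metric_projP {K} x : convex_body K -> K (metric_proj K x) /\
  forall z, K z -> enorm (x - metric_proj K x) <= enorm (x - z).
Proof.
move=> [K0 cK _].
pose P := [set y | K y /\ forall z, K z -> enorm (x - y) <= enorm (x - z)].
suff : exists y, P y by move=> /(xgetPex 0).
have cont : continuous (fun y : 'rV[R]_n => enorm (x - y)).
  move=> y; apply: (@continuous_comp _ _ _ (fun y => x - y) (@enorm R n)).
    by apply: continuousB; [exact: cst_continuous | exact: cvg_id].
  exact: enorm_continuous.
have [c cK' cmin] := EVT_min_rV K0 cK (continuous_subspaceT cont).
by exists c; split; [exact/set_mem | move=> z Kz; exact/cmin/mem_set].
Qed.

Lemma metric_proj_in {K} x : convex_body K -> K (metric_proj K x).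
Proof. by move=> /(metric_projP x)[]. Qed.

Lemma body_dist_le {K x z} : convex_body K -> K z -> body_dist K x <= enorm (x - z).
Proof. by move=> /(metric_projP x)[_]; exact. Qed.

Lemma body_dist_ge0 K x : 0 <= body_dist K x. Proof. exact: enorm_ge0. Qed.

Lemma body_dist_in {K x} : convex_body K -> K x -> body_dist K x = 0.
Proof.
move=> cK Kx; apply/le_anti; rewrite body_dist_ge0 andbT.
by rewrite (le_trans (body_dist_le cK Kx))// subrr enorm0.
Qed.

(** If the angle were acute, a short move from the projection towards [z], which stays in [K] by
    convexity, would bring the point closer to [x]. *)
Lemma metric_proj_obtuse {K x z} : convex_body K -> K z ->
  dotp (x - metric_proj K x) (z - metric_proj K x) <= 0.
Proof.
move=> cK Kz; have [Kp pmin] := metric_projP x cK.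
set p := metric_proj K x in Kp pmin *.
rewrite leNgt; apply/negP => d_gt0.
set d := dotp _ _ in d_gt0; set w := dotp (z - p) (z - p).
have w0 : 0 <= w by exact: dotp_ge0.
have D0 : 0 < d + w + 1 by lra.
(* Minimality at parameter [t] gives [2 * d <= t * w]. This choice lies in the interval from 0 to 1
   and satisfies [t * w <= d], a contradiction. *)
pose t := d / (d + w + 1).
have t0 : 0 < t by rewrite divr_gt0.
have t1 : t <= 1 by rewrite ler_pdivrMr// mul1r; lra.
have Kt : K (p + t *: (z - p)).
  case: cK => _ _ /(_ z p (Itv01 (ltW t0) t1) (mem_set Kz) (mem_set Kp))/set_mem.
  rewrite /conv /=; congr K; rewrite /unstable.onem.
  by rewrite scalerBr scalerBl scale1r addrC addrAC -addrA.
have := pmin _ Kt.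
rewrite -(@ler_pXn2r _ 2)// ?nnegrE ?enorm_ge0// opprD addrA.
rewrite [X in _ <= X]enorm_sqrB [enorm (t *: _) ^+ 2]enorm_sqr.
rewrite !(dotpZl, dotpZr) -/d -/w => le_d.
have : t * (2 * d) <= t * (t * w) by lra.
rewrite ler_pM2l// => {}le_d.
have : t * w <= d by rewrite mulrAC ler_pdivrMr// ler_wpM2l; lra.
lra.
Qed.

Lemma parallel_body_dist K rho x : convex_body K -> 0 <= rho ->
  parallel K rho x -> body_dist K x <= rho.
Proof.
move=> cK rho0 [k Kk] [b /= b1 <-].
rewrite (le_trans (body_dist_le cK Kk))// addrAC subrr add0r enormZ ger0_norm//.
by rewrite ler_piMr//; move: b1; rewrite /eball /= subr0.
Qed.

Lemma body_dist_parallel K rho x : convex_body K -> 0 < rho ->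
  body_dist K x <= rho -> parallel K rho x.
Proof.
move=> cK rho0 dx; exists (metric_proj K x); first exact: metric_proj_in.
exists (rho^-1 *: (x - metric_proj K x)) => /=.
  rewrite /eball /= subr0 enormZ ger0_norm ?invr_ge0 ?(ltW rho0)//.
  by rewrite ler_pdivrMl// mulr1.
by rewrite scalerA divff ?gt_eqF// scale1r addrC subrK.
Qed.

Lemma parallelE K rho x : convex_body K -> 0 < rho ->
  parallel K rho x <-> body_dist K x <= rho.
Proof.
move=> cK rho0; split; last exact: body_dist_parallel.
by apply: parallel_body_dist => //; exact: ltW.
Qed.

Lemma body_dist_lip K x y : convex_body K ->
  body_dist K y <= body_dist K x + enorm (x - y).
Proof.
move=> cK; rewrite (le_trans (body_dist_le cK (metric_proj_in x cK)))//.
by rewrite (le_trans (enorm_triangle x _ _))// addrC (enormC y).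
Qed.

Section two_bodies.
Variables (K L : set 'rV[R]_n) (delta : R).
Hypotheses (cK : convex_body K) (cL : convex_body L) (delta0 : 0 <= delta).
Hypotheses (KL : K `<=` parallel L delta) (LK : L `<=` parallel K delta).

Lemma body_dist_hausdorff x : body_dist L x <= body_dist K x + delta.
Proof.
have [q Lq [b /= b1 qb]] := KL (metric_proj_in x cK).
rewrite (le_trans (body_dist_le cL Lq))//.
rewrite (le_trans (enorm_triangle (metric_proj K x) _ _))// lerD2l.
rewrite -qb addrAC subrr add0r enormZ ger0_norm//.
by rewrite ler_piMr//; move: b1; rewrite /eball /= subr0.
Qed.

(* With [q'] a point of [L] within [delta] of [p_K x], obtuseness of the angles
   at the two projections gives |p - q|^2 <= delta (d_K x + d_L x). *)
Lemma metric_proj_hausdorff x :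
  enorm (metric_proj K x - metric_proj L x) ^+ 2 <=
  (body_dist K x + body_dist L x) * delta.
Proof.
set p := metric_proj K x; set q := metric_proj L x.
have le_delta (M M' : set 'rV[R]_n) : convex_body M -> convex_body M' ->
    M `<=` parallel M' delta ->
    dotp (x - metric_proj M' x) (metric_proj M x - metric_proj M' x) <=
    body_dist M' x * delta.
  move=> cM cM' MM'.
  have [z Mz [b /= b1 zb]] := MM' _ (metric_proj_in x cM).
  have := metric_proj_obtuse (x := x) cM' Mz.
  have : dotp (x - metric_proj M' x) (metric_proj M x - z) <=
         body_dist M' x * delta.
    rewrite (le_trans (dotp_le _ _))// ler_wpM2l ?enorm_ge0//.
    rewrite -zb addrAC subrr add0r enormZ ger0_norm//.
    by rewrite ler_piMr//; move: b1; rewrite /eball /= subr0.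
  by rewrite !dotpBr; lra.
(* The two scalar products on the left add up to the squared norm of [p - q]. *)
have := le_delta _ _ cK cL KL; have := le_delta _ _ cL cK LK.
rewrite -/p -/q enorm_sqr !dotpBl !dotpBr; lra.
Qed.

End two_bodies.

Lemma outer_dir_stable K L x : 1 <= body_dist K x -> 1 <= body_dist L x ->
  enorm (outer_dir K x - outer_dir L x) <=
  2 * enorm (metric_proj K x - metric_proj L x).
Proof.
rewrite /outer_dir /body_dist.
set p := metric_proj K x; set q := metric_proj L x => a1 b1.
set a := enorm (x - p) in a1 *; set b := enorm (x - q) in b1 *.
(* The first term is the change of base point, the second the change of length. Each has norm at
   most that of [p - q], because [a >= 1]. *)
have -> : a^-1 *: (x - p) - b^-1 *: (x - q) =
          a^-1 *: (q - p) + (a^-1 - b^-1) *: (x - q).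
  by apply/rowP => i; rewrite !mxE; ring.
rewrite (le_trans (enormD _ _))// !enormZ -/b (enormC q p).
have a0 : 0 < a by lra.
have b0 : 0 < b by lra.
have ai : a^-1 <= 1 by rewrite invf_le1.
have ab : `|b - a| <= enorm (p - q).
  have := enorm_triangle p x q; have := enorm_triangle q x p.
  by rewrite -/a -/b (enormC q p) => *; rewrite ler_norml; apply/andP; split; lra.
rewrite [2 * _]mulrDl mul1r lerD//.
  by rewrite ger0_norm ?invr_ge0 ?(ltW a0)// ler_piMl ?enorm_ge0.
have -> : `|a^-1 - b^-1| * b = a^-1 * `|b - a|.
  rewrite -[X in _ * X](gtr0_norm b0) -[X in X * `|b - a|]gtr0_norm ?invr_gt0//.
  by rewrite -!normrM; congr `|_|; field; rewrite ?gt_eqF.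
by rewrite (le_trans _ ab)// ler_piMl.
Qed.

End projection.

(** * The Hausdorff outer measure *)

Section kappa.
Context {R : realType}.

Lemma volume_ge0 n (A : set 'rV[R]_n) : (0 <= volume A)%E.
Proof.
elim: n A => [|n IH] A /=; first by rewrite lee_fin ler0n.
by apply: integral_ge0 => t _; exact: IH.
Qed.

Lemma kappa_ge0 n : 0 <= kappa n :> R.
Proof. by rewrite fine_ge0// volume_ge0. Qed.

End kappa.

Section extended_reals.
Context {R : realType}.
Local Open Scope ereal_scope.

Lemma lee_expe (x y : \bar R) n : 0 <= x -> x <= y -> x ^+ n <= y ^+ n.
Proof.
move=> x0 xy; elim: n => [|n IH]; first by rewrite !expe0.
by rewrite !expeS lee_pmul// expe_ge0.
Qed.

Lemma nneseries_le_bound (u : (\bar R)^nat) b : (forall k, 0 <= u k) ->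
  (forall m, \sum_(0 <= k < m) u k <= b) -> \sum_(k <oo) u k <= b.
Proof.
move=> u0 ub; apply: lime_le; first exact: is_cvg_nneseries.
by apply: nearW => m; exact: ub.
Qed.

(** Merges a cover of one set and a cover of another into a single sequence covering the union. *)
Definition interleave {T : Type} (u v : nat -> T) (k : nat) : T :=
  if odd k then v k./2 else u k./2.

(** A partial sum of length [m] is at most the one of length [m.*2], which consists of exactly [m]
    terms from each sequence. *)
Lemma interleave_series {T : Type} (g : T -> \bar R) (u v : nat -> T) :
  (forall x, 0 <= g x) ->
  \sum_(k <oo) g (interleave u v k) <=
  \sum_(k <oo) g (u k) + \sum_(k <oo) g (v k).
Proof.
move=> g0; apply: nneseries_le_bound => // m.
have -> : \sum_(0 <= k < m) g (interleave u v k) =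
          \sum_(k < m) g (interleave u v k) by rewrite big_mkord.
rewrite (@le_trans _ _ (\sum_(0 <= k < m.*2) g (interleave u v k)))//.
  rewrite -(big_mkord xpredT (fun k => g (interleave u v k))).
  rewrite (@big_cat_nat _ _ _ m 0 m.*2)//= ?leeDl//; last by rewrite -addnn leq_addr.
  by apply: sume_ge0 => k _.
rewrite (@le_trans _ _ (\sum_(0 <= k < m) g (u k) + \sum_(0 <= k < m) g (v k)))//.
  elim: m => [|m IH]; first by rewrite !big_geq// adde0.
  rewrite doubleS !big_nat_recr//= /interleave /= odd_double/= doubleK.
  rewrite uphalf_double -addeA addeACA leeD2r//.
by rewrite leeD// nneseries_lim_ge.
Qed.

End extended_reals.

Section hausdorff.
Context {R : realType} {n : nat}.
Implicit Types (A B : set 'rV[R]_n) (U : (set 'rV[R]_n)^nat).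
Local Open Scope ereal_scope.

Lemma diam_ge0 A : 0 <= diam A.
Proof. by apply: ereal_sup_ubound; left. Qed.

Lemma diam_le A d : (0 <= d)%R ->
  (forall x y, A x -> A y -> (enorm (x - y) <= d)%R) -> diam A <= d%:E.
Proof.
move=> d0 Ad; apply: ge_ereal_sup => _ [->|[x Ax [y Ay <-]]]; first by rewrite lee_fin.
by rewrite lee_fin Ad.
Qed.

Lemma enorm_le_diam A x y : A x -> A y -> (enorm (x - y))%:E <= diam A.
Proof. by move=> Ax Ay; apply: ereal_sup_ubound; right; exists x => //; exists y. Qed.

Lemma diam_set0 : diam (set0 : set 'rV[R]_n) = 0.
Proof. by apply/le_anti; rewrite diam_ge0 andbT; apply: diam_le => // x y []. Qed.

Lemma le_diam A B : A `<=` B -> diam A <= diam B.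
Proof.
move=> AB; apply: ereal_sup_le => _ [->|[x Ax [y Ay <-]]]; first by left.
by right; exists x; [exact: AB | exists y => //; exact: AB].
Qed.

Definition diam_weight A : \bar R := (kappa n / 2 ^+ n)%R%:E * diam A ^+ n.

Definition delta_cover (delta : R) A : set ((set 'rV[R]_n)^nat) :=
  [set U | (forall k, diam (U k) <= delta%:E) /\ A `<=` \bigcup_k U k].

Lemma hausdorff_contentE delta A : hausdorff_content delta A =
  ereal_inf [set \sum_(k <oo) diam_weight (U k) | U in delta_cover delta A].
Proof. by []. Qed.

Lemma diam_weight_ge0 A : 0 <= diam_weight A.
Proof.
apply: mule_ge0; last exact/expe_ge0/diam_ge0.
by rewrite lee_fin divr_ge0// ?kappa_ge0// exprn_ge0.
Qed.

Lemma diam_weight_set0 : (0 < n)%N -> diam_weight set0 = 0.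
Proof.
move=> n0; rewrite /diam_weight diam_set0 (_ : 0 ^+ n = 0) ?mule0//.
by apply/eqP; rewrite expe_eq0 n0 eqxx.
Qed.

Lemma hausdorff_content_ge0 delta A : 0 <= hausdorff_content delta A.
Proof.
rewrite hausdorff_contentE; apply: le_ereal_inf_tmp => _ [U _ <-].
by apply: nneseries_ge0 => k _ _; exact: diam_weight_ge0.
Qed.

Lemma hausdorff_content_le delta A U : delta_cover delta A U ->
  hausdorff_content delta A <= \sum_(k <oo) diam_weight (U k).
Proof. by move=> AU; apply: ereal_inf_lbound; exists U. Qed.

Lemma hausdorff_content_adherent delta A e : (0 < e)%R ->
  hausdorff_content delta A \is a fin_num ->
  exists2 U, delta_cover delta A U &
    \sum_(k <oo) diam_weight (U k) <= hausdorff_content delta A + e%:E.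
Proof.
move=> e0 /(lb_ereal_inf_adherent e0)[_ [U AU <-] /ltW].
by exists U.
Qed.

Lemma le_hausdorff_content delta delta' A B : (delta' <= delta)%R -> A `<=` B ->
  hausdorff_content delta A <= hausdorff_content delta' B.
Proof.
move=> dd AB; rewrite [leRHS]hausdorff_contentE.
apply: le_ereal_inf_tmp => _ [U [dU BU] <-]; apply: hausdorff_content_le.
by split=> [k|]; [rewrite (le_trans (dU k))// lee_fin | exact: subset_trans BU].
Qed.

(** Unless a content is infinite, interleave two covers that are optimal up to [e / 2]. *)
Lemma hausdorff_contentU delta A B : hausdorff_content delta (A `|` B) <=
  hausdorff_content delta A + hausdorff_content delta B.
Proof.
have [/eqP->|Aoo] := boolP (hausdorff_content delta A == +oo).
  by rewrite addye ?leey// gt_eqF// (lt_le_trans _ (hausdorff_content_ge0 _ _))// ltNyr.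
have [/eqP->|Boo] := boolP (hausdorff_content delta B == +oo).
  by rewrite addey ?leey// gt_eqF// (lt_le_trans _ (hausdorff_content_ge0 _ _))// ltNyr.
have Afin : hausdorff_content delta A \is a fin_num.
  by rewrite ge0_fin_numE ?hausdorff_content_ge0// ltey.
have Bfin : hausdorff_content delta B \is a fin_num.
  by rewrite ge0_fin_numE ?hausdorff_content_ge0// ltey.
apply/lee_addgt0Pr => e e0.
have e20 : (0 < e / 2)%R by rewrite divr_gt0.
have [U [dU AU] leU] := hausdorff_content_adherent e20 Afin.
have [V [dV BV] leV] := hausdorff_content_adherent e20 Bfin.
rewrite [X in X%:E](splitr e) EFinD addeACA.
rewrite (le_trans _ (leeD leU leV))//.
rewrite (le_trans _ (interleave_series U V diam_weight_ge0))//.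
apply: hausdorff_content_le; split=> [k|x].
  by rewrite /interleave; case: ifP.
case=> [/AU[k _ Uk]|/BV[k _ Vk]].
  by exists k.*2 => //; rewrite /interleave odd_double doubleK.
by exists k.*2.+1 => //; rewrite /interleave /= odd_double/= uphalf_double.
Qed.

Lemma hausdorff_content_le_measure delta A : (0 < delta)%R ->
  hausdorff_content delta A <= hausdorff_measure A.
Proof. by move=> d0; apply: ereal_sup_ubound; exists delta. Qed.

Lemma hausdorff_measure_ge0 A : 0 <= hausdorff_measure A.
Proof.
by rewrite (le_trans (hausdorff_content_ge0 1 A))// hausdorff_content_le_measure.
Qed.

Lemma le_hausdorff_measure A B : A `<=` B ->
  hausdorff_measure A <= hausdorff_measure B.
Proof.
move=> AB; apply: ge_ereal_sup => _ [d /= d0 <-].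
by rewrite (le_trans (le_hausdorff_content (lexx d) AB))// hausdorff_content_le_measure.
Qed.

Lemma hausdorff_measureU A B : hausdorff_measure (A `|` B) <=
  hausdorff_measure A + hausdorff_measure B.
Proof.
apply: ge_ereal_sup => _ [d /= d0 <-].
by rewrite (le_trans (hausdorff_contentU _ _ _))// leeD// hausdorff_content_le_measure.
Qed.

Section separated.
Variables (A B : set 'rV[R]_n) (s : R).
Hypotheses (n0 : (0 < n)%N) (s0 : (0 < s)%R).
Hypothesis sepAB : forall x y, A x -> B y -> (s <= enorm (x - y))%R.

(** A set of diameter below [s] meets at most one of [A] and [B]. Hence restricting a cover of the
    union to [A] and to [B] splits it without increasing the total weight, empty traces having
    weight 0. *)
Lemma hausdorff_content_separated delta : (delta < s)%R ->
  hausdorff_content delta A + hausdorff_content delta B <=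
  hausdorff_content delta (A `|` B).
Proof.
move=> ds; rewrite [leRHS]hausdorff_contentE.
apply: le_ereal_inf_tmp => _ [U [dU ABU] <-].
have coverI C : C `<=` A `|` B -> delta_cover delta C (fun k => U k `&` C).
  move=> CAB; split=> [k|x Cx].
    by rewrite (le_trans _ (dU k))// le_diam// => x [].
  by have [k _ Ukx] := ABU _ (CAB _ Cx); exists k.
rewrite (le_trans (leeD (hausdorff_content_le (coverI A _))
                        (hausdorff_content_le (coverI B _))))//.
rewrite -nneseriesD; [|by move=> *; exact: diam_weight_ge0..].
apply: lee_nneseries => [k _ _|k _]; first by rewrite adde_ge0 ?diam_weight_ge0.
have le_weight C : diam_weight (U k `&` C) <= diam_weight (U k).
  apply: lee_wpmul2l; first by rewrite lee_fin divr_ge0// ?kappa_ge0// exprn_ge0.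
  by apply: lee_expe; [exact: diam_ge0 | apply: le_diam => x []].
have weight0 := diam_weight_set0 n0.
have [->|/set0P[x [Ux Ax]]] := eqVneq (U k `&` A) set0; first by rewrite weight0 add0e.
have [->|/set0P[y [Uy By]]] := eqVneq (U k `&` B) set0; first by rewrite weight0 adde0.
exfalso; have := le_trans (enorm_le_diam Ux Uy) (dU k).
by rewrite lee_fin leNgt (lt_le_trans ds)// sepAB.
Qed.

Lemma hausdorff_measure_separated :
  hausdorff_measure A + hausdorff_measure B <= hausdorff_measure (A `|` B).
Proof.
have [/eqP->|ABoo] := boolP (hausdorff_measure (A `|` B) == +oo); first by rewrite leey.
have ABfin C : C `<=` A `|` B -> hausdorff_measure C \is a fin_num.
  move=> /le_hausdorff_measure CAB; rewrite ge0_fin_numE ?hausdorff_measure_ge0//.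
  by rewrite (le_lt_trans CAB)// ltey.
have cfin d C : (0 < d)%R -> C `<=` A `|` B -> hausdorff_content d C \is a fin_num.
  move=> d0 /ABfin; rewrite !ge0_fin_numE ?hausdorff_measure_ge0 ?hausdorff_content_ge0//.
  by apply: le_lt_trans; exact: hausdorff_content_le_measure.
(* The two suprema run over independent scales; both are refined to a common scale below [s], where
   the contents add up. *)
have le_content d1 d2 : (0 < d1)%R -> (0 < d2)%R ->
    hausdorff_content d1 A + hausdorff_content d2 B <= hausdorff_measure (A `|` B).
  move=> d10 d20; set d : R := Num.min (s / 2)%R (Num.min d1 d2).
  have d0 : (0 < d)%R by rewrite !lt_min d10 d20 divr_gt0.
  have [d_s d_1 d_2] : [/\ (d <= s / 2)%R, (d <= d1)%R & (d <= d2)%R].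
    by rewrite !ge_min !lexx !orbT.
  rewrite (le_trans _ (hausdorff_content_le_measure (A `|` B) d0))//.
  rewrite (le_trans _ (hausdorff_content_separated _))//; last first.
    by rewrite (le_lt_trans d_s)// ltr_pdivrMr// mulr_natr mulr2n ltrDl.
  by rewrite leeD// le_hausdorff_content.
have AfinE := ABfin _ (@subsetUl _ A B).
rewrite -leeBrDl//.
apply: ge_ereal_sup => _ [d2 /= d20 <-].
rewrite leeBrDl// -leeBrDr ?cfin//.
apply: ge_ereal_sup => _ [d1 /= d10 <-].
by rewrite leeBrDr ?cfin// le_content.
Qed.

End separated.

End hausdorff.

(** * Volumes of balls and cubes *)

Section ball.
Context {R : realType} {n : nat}.

Lemma nneseries_finite_bound (u : (\bar R)^nat) M b : 0 <= b ->
  (forall k, (0 <= u k)%E) -> (forall k, (k < M)%N -> (u k <= b%:E)%E) ->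
  (forall k, (M <= k)%N -> u k = 0%E) ->
  (\sum_(k <oo) u k <= (M%:R * b)%:E)%E.
Proof.
move=> b0 u0 ub uM; apply: nneseries_le_bound => // m.
rewrite (@le_trans _ _ ((minn m M)%:R * b)%:E)//; last first.
  by rewrite lee_fin ler_wpM2r// ler_nat geq_minr.
elim: m => [|m IH]; first by rewrite big_geq// min0n mul0r.
rewrite big_nat_recr//=; have [mM|Mm] := ltnP m M.
  rewrite (minn_idPl mM) -natr1 mulrDl mul1r EFinD leeD ?ub//.
  by rewrite (le_trans IH)// (minn_idPl (ltnW mM)).
by rewrite uM// adde0 (le_trans IH)// (minn_idPr Mm) (minn_idPr (leqW Mm)).
Qed.

(* The circumscribed cube is cut into cubes of side [2 r / m]: there are at most
   [(m + 1) ^ n] of them meeting the ball, each of diameter at most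
   [n * (2 r / m)]. *)
Lemma hausdorff_content_eball (c : 'rV[R]_n) r delta :
  (0 < n)%N -> 0 < r -> 0 < delta ->
  (hausdorff_content delta (eball c r) <=
   (kappa n / 2 ^+ n * (n%:R * (4 * r)) ^+ n)%:E)%E.
Proof.
move=> n0 r0 delta0.
(* So many subdivisions that the diameter bound [n%:R * h] of a small cube is at most [delta]. *)
pose m := (Num.truncn (n%:R * (2 * r) / delta)).+1.
have m0 : 0 < m%:R :> R by rewrite ltr0n.
pose h := 2 * r / m%:R.
have h0 : 0 < h by rewrite !(divr_gt0, mulr_gt0).
have nh : n%:R * h <= delta.
  rewrite /h mulrA ler_pdivrMr// [leRHS]mulrC -ler_pdivrMr//.
  exact/ltW/truncnS_gt.
(* Each coordinate has [m + 1] indices rather than [m]: the truncation equals [m] on the far face of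
   the big cube. *)
pose G := {ffun 'I_n -> 'I_m.+1}.
pose piece (g : G) : set 'rV[R]_n := [set x | forall i,
  (g i)%:R * h <= x ord0 i - c ord0 i + r <= (g i).+1%:R * h].
pose s := [seq piece g | g <- enum G].
have sG : size s = (m.+1 ^ n)%N by rewrite size_map -cardT card_ffun !card_ord.
have diam_piece g : (diam (piece g) <= (n%:R * h)%:E)%E.
  apply: diam_le => [|x y gx gy]; first by rewrite mulr_ge0// ltW.
  apply: enorm_le_coord => [|i]; first exact: ltW.
  have := gx i; have := gy i; rewrite !mxE -natr1 mulrDl mul1r.
  move=> /andP[? ?] /andP[? ?]; rewrite ler_norml; apply/andP; split; lra.
pose b := kappa n / 2 ^+ n * (n%:R * h) ^+ n.
have kn0 : 0 <= kappa n / 2 ^+ n :> R by rewrite divr_ge0 ?kappa_ge0// exprn_ge0.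
have nh0 : 0 <= n%:R * h by rewrite mulr_ge0// ltW.
have b0 : 0 <= b by rewrite mulr_ge0// exprn_ge0.
have cover : delta_cover delta (eball c r) (nth set0 s).
  split=> [k|x /= xr].
    have [ks|ks] := ltnP k (size s); last first.
      by rewrite nth_default// diam_set0 lee_fin ltW.
    have /mapP[g _ ->] := mem_nth set0 ks.
    by rewrite (le_trans (diam_piece g))// lee_fin.
  have xri i : 0 <= x ord0 i - c ord0 i + r <= 2 * r.
    have := coord_le_enorm (x - c) i; rewrite !mxE ler_norml => /andP[].
    by move: xr; rewrite /eball /= => *; apply/andP; split; lra.
  pose g : G := [ffun i => inord (Num.truncn ((x ord0 i - c ord0 i + r) / h))].
  exists (index (piece g) s) => //.
  rewrite nth_index ?map_f ?mem_enum// => i.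
  have /andP[x0 x2r] := xri i.
  have xh0 : 0 <= (x ord0 i - c ord0 i + r) / h by rewrite divr_ge0// ltW.
  have /andP[tle tlt] := truncn_itv xh0.
  have tm : (Num.truncn ((x ord0 i - c ord0 i + r) / h) < m.+1)%N.
    rewrite ltnS -(ler_nat R) (le_trans tle)// ler_pdivrMr//.
    by rewrite /h mulrC divfK ?gt_eqF.
  rewrite ffunE inordK//; apply/andP; split.
    by rewrite -ler_pdivlMr.
  by rewrite -ler_pdivrMr// ltW.
rewrite (le_trans (hausdorff_content_le cover))//.
rewrite (@le_trans _ _ ((m.+1 ^ n)%:R * b)%:E)//.
  apply: nneseries_finite_bound => // [k|k|k].
  - exact: diam_weight_ge0.
  - rewrite -sG => ks; have /mapP[g _ ->] := mem_nth set0 ks.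
    rewrite /diam_weight /b [leRHS]EFinM EFin_expe lee_wpmul2l//.
    by rewrite lee_expe// ?diam_ge0.
  - rewrite -sG => ks; by rewrite nth_default// diam_weight_set0.
rewrite lee_fin /b mulrCA ler_wpM2l// natrX -exprMn lerXn2r ?nnegrE ?mulr_ge0//.
  by rewrite ltW.
  by rewrite ltW.
(* Since [m + 1 <= 2 * m], the factor [(m + 1) * h] is at most [4 * r], so the bound no longer
   involves [delta]. *)
rewrite mulrCA ler_wpM2l// /h mulrA ler_pdivrMr// -natr1.
have : 1 <= m%:R :> R by rewrite ler1n.
nra.
Qed.

End ball.

Section cubes.
Context {R : realType}.

(** Slice volumes of arbitrary sets come without measurability, so monotonicity is read off the
    supremum over simple functions. *)
Lemma le_integral_ge0 (f g : R -> \bar R) : (forall t, 0 <= f t)%E ->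
  (forall t, f t <= g t)%E ->
  (\int[lebesgue_measure]_t f t <= \int[lebesgue_measure]_t g t)%E.
Proof.
move=> f0 fg; have g0 t : (0 <= g t)%E by rewrite (le_trans (f0 t)).
rewrite !ge0_integralTE//; apply: ereal_sup_le => _ [h /= hf <-].
by exists h => //= t; rewrite (le_trans (hf t)).
Qed.

Lemma le_volume n (A B : set 'rV[R]_n) : A `<=` B -> (volume A <= volume B)%E.
Proof.
elim: n A B => [|n IH] A B AB /=.
  rewrite lee_fin ler_nat; case: (boolP (_ \in A)) => // /set_mem/AB/mem_set.
  by move=> ->.
apply: le_integral_ge0 => t; first exact: volume_ge0.
by apply: IH => y; exact: AB.
Qed.

Lemma volume_set0 n : volume (set0 : set 'rV[R]_n) = 0%E.
Proof.
elim: n => [|n IH] /=; first by rewrite in_set0.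
by rewrite -[RHS](@integral0 _ _ R lebesgue_measure setT); apply: eq_integral.
Qed.

Definition cube {n} (a b : R) : set 'rV[R]_n :=
  [set x | forall i, a <= x ord0 i <= b].

Lemma volume_cube n (a b : R) : a <= b ->
  volume (@cube n a b) = ((b - a) ^+ n)%:E.
Proof.
move=> ab; elim: n => [|n IH] /=; first by rewrite mem_set// => -[].
have sliceE t : volume [set y : 'rV[R]_n |
    @cube n.+1 a b (row_mx (t%:M : 'rV[R]_1) y)] =
    ((cst ((b - a) ^+ n)%:E) \_ `[a, b]) t.
  have cubeE y : @cube n.+1 a b (row_mx (t%:M : 'rV[R]_1) y) <->
      a <= t <= b /\ @cube n a b y.
    split=> [h|[tab yab] i].
      split=> [|j].
        by have := h (lshift n (ord0 : 'I_1)); rewrite (@row_mxEl _ 1 1 n) mxE mulr1n.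
      by have := h (rshift 1 j); rewrite (@row_mxEr _ 1 1 n).
    rewrite -(splitK (i : 'I_(1 + n))).
    case: (fintype.split (i : 'I_(1 + n))) => j /=.
      by rewrite (@row_mxEl _ 1 1 n) mxE !ord1 mulr1n.
    by rewrite (@row_mxEr _ 1 1 n).
  rewrite patchE; have [tab|tab] := boolP (a <= t <= b).
    rewrite mem_set /= ?in_itv//= -IH.
    by congr volume; apply/seteqP; split=> y; [case/cubeE | move=> yab; exact/cubeE].
  rewrite memNset /= ?in_itv//=; last exact/negP.
  rewrite (_ : [set _ | _] = set0) ?volume_set0//.
  by rewrite -subset0 => y /cubeE[tab'] _; rewrite tab' in tab.
under eq_integral do rewrite sliceE.
rewrite -integral_mkcond integral_cst//= lebesgue_measure_itv/= lte_fin.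
case: ltgtP ab => // [ab _|->]; first by rewrite -EFinD -EFinM -exprSr.
by rewrite mule0 subrr expr0n.
Qed.

(** The ball contains a cube of positive side and is contained in a bounded one. The second
    inclusion makes its volume finite, so that [fine] does not collapse it to 0. *)
Lemma kappa_gt0 n : 0 < kappa n :> R.
Proof.
have n0 : 0 < n.+1%:R^-1 :> R by rewrite invr_gt0.
have sub1 : @cube n (- n.+1%:R^-1) n.+1%:R^-1 `<=` eball (0 : 'rV[R]_n) 1.
  move=> x xc; rewrite /eball /= subr0.
  have /enorm_le_coord /le_trans : forall i, `|x ord0 i| <= n.+1%:R^-1.
    by move=> i; rewrite ler_norml.
  apply; first exact: ltW.
  by rewrite ler_pdivrMr// mul1r ler_nat.
have sub2 : eball (0 : 'rV[R]_n) 1 `<=` @cube n (- 1) 1.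
  move=> x; rewrite /eball /= subr0 => x1 i.
  by rewrite -ler_norml (le_trans (coord_le_enorm _ _)).
have := le_volume sub2; have := le_volume sub1.
rewrite volume_cube; last by rewrite (le_trans _ (ltW n0))// oppr_le0 ltW.
rewrite volume_cube; last by rewrite (le_trans (lerN10 R)).
rewrite /kappa; case: (volume _) => [v| |]//=; rewrite lee_fin => + _.
by apply: lt_le_trans; rewrite exprn_gt0// opprK addr_gt0.
Qed.

End cubes.

(** * Shells and the Steiner polynomial *)

(** A mean value estimate, by induction on [k]; the crude power [B ^+ k] avoids a predecessor. *)
Lemma expr_sub_le (R : realType) (x y B : R) k : 0 <= x -> x <= y -> y <= B ->
  1 <= B -> y ^+ k - x ^+ k <= k%:R * B ^+ k * (y - x).
Proof.
move=> x0 xy yB B1; elim: k => [|k IH]; first by rewrite !expr0 subrr mul0r mul0r.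
have -> : y ^+ k.+1 - x ^+ k.+1 = y * (y ^+ k - x ^+ k) + x ^+ k * (y - x).
  by rewrite !exprS; ring.
have xk : x ^+ k <= B ^+ k by rewrite lerXn2r ?nnegrE; lra.
have Bk : 0 <= B ^+ k by rewrite exprn_ge0//; lra.
have yk : 0 <= y ^+ k - x ^+ k by rewrite subr_ge0 lerXn2r ?nnegrE; lra.
have le1 : y * (y ^+ k - x ^+ k) <= B * (k%:R * B ^+ k * (y - x)).
  by apply: ler_pM => //; lra.
have le2 : x ^+ k * (y - x) <= B * B ^+ k * (y - x).
  rewrite ler_wpM2r; [by []|lra|].
  by rewrite (le_trans xk)// ler_peMl.
rewrite -natr1 exprS; lra.
Qed.

Section shells.
Context {R : realType} {n : nat}.
Local Notation N := n.+1.
Implicit Types (K : set 'rV[R]_N) (eta : set (SigmaB R n)) (x : 'rV[R]_N).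

Definition normal_pair K x := (metric_proj K x, outer_dir K x).

(** Half-open in the distance, so that consecutive shells are disjoint and the local parallel set is
    the shell starting at 0. *)
Definition shell K (a b : R) eta : set 'rV[R]_N :=
  [set x | a < body_dist K x <= b /\ (val @` eta) (normal_pair K x)].

Lemma body_dist_eq0 K x : convex_body K -> body_dist K x = 0 -> K x.
Proof.
move=> cK /enorm_eq0/eqP; rewrite subr_eq0 => /eqP ->.
exact: metric_proj_in.
Qed.

Lemma local_parallelE K rho eta : convex_body K -> 0 < rho ->
  local_parallel K rho eta = shell K 0 rho eta.
Proof.
move=> cK rho0; apply/seteqP; split=> x.
  move=> [[/(parallelE x cK rho0) dx nKx] etax]; split=> //; rewrite dx andbT.
  rewrite lt_neqAle body_dist_ge0 andbT eq_sym.
  by apply/eqP => /(body_dist_eq0 cK).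
move=> [/andP[dx0 dx] etax]; split=> //; split; first exact/parallelE.
by move=> Kx; move: dx0; rewrite (body_dist_in cK Kx) ltxx.
Qed.

Section steiner.
Variables (K : set 'rV[R]_N) (Lam : 'I_N -> {finite_measure set (SigmaB R n) -> \bar R}).
Hypotheses (cK : convex_body K) (sK : support_measures K Lam).

(** The real coefficient of [rho ^+ (N - i)] in the Steiner polynomial. *)
Definition steiner_coef eta (i : 'I_N) : R := kappa (N - i) * fine (Lam i eta).

Lemma steiner_coef_ge0 eta i : 0 <= steiner_coef eta i.
Proof. by rewrite mulr_ge0 ?kappa_ge0// fine_ge0. Qed.

Lemma shell0_measure rho eta : 0 < rho -> measurable eta ->
  hausdorff_measure (shell K 0 rho eta) =
  (\sum_(i < N) rho ^+ (N - i) * steiner_coef eta i)%:E.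
Proof.
move=> rho0 meta; have := sK rho0 meta.
rewrite /mu_parallel local_parallelE// => ->.
rewrite -sumEFin; apply: eq_bigr => i _.
by rewrite /steiner_coef mulrA [in RHS]EFinM fineK// fin_num_measure.
Qed.

(* Points of [shell K 0 a'] and [shell K a b] are at distance at least [a - a'],
   so their measures add up; then [a'] tends to [a] in the Steiner polynomial. *)
Lemma shell_measure a b eta : 0 < a -> a < b -> measurable eta ->
  hausdorff_measure (shell K a b eta) =
  (\sum_(i < N) (b ^+ (N - i) - a ^+ (N - i)) * steiner_coef eta i)%:E.
Proof.
move=> a0 ab meta; have b0 : 0 < b by lra.
pose P (t : R) := \sum_(i < N) t ^+ (N - i) * steiner_coef eta i.
have -> : \sum_(i < N) (b ^+ (N - i) - a ^+ (N - i)) * steiner_coef eta i =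
          P b - P a.
  by rewrite /P -sumrB; apply: eq_bigr => i _; rewrite mulrBl.
have Sfin : hausdorff_measure (shell K a b eta) \is a fin_num.
  rewrite ge0_fin_numE ?hausdorff_measure_ge0//.
  apply: (@le_lt_trans _ _ (hausdorff_measure (shell K 0 b eta))).
    apply: le_hausdorff_measure => x [/andP[ax xb] etax]; split=> //.
    by rewrite xb andbT (lt_trans a0).
  by rewrite shell0_measure// ltry.
have [s Ss] : exists s, hausdorff_measure (shell K a b eta) = s%:E.
  by exists (fine (hausdorff_measure (shell K a b eta))); rewrite fineK.
(* The lower bound [P b - P a <= s] is subadditivity; the upper bound needs the gap between [a'] and
   [a]. *)
rewrite Ss; congr EFin; apply/le_anti/andP; split; last first.
  suff : (P b)%:E = hausdorff_measure (shell K 0 b eta) /\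
         (hausdorff_measure (shell K 0 b eta) <= (P a)%:E + s%:E)%E.
    by move=> [<-]; rewrite -EFinD lee_fin; lra.
  split; first by rewrite shell0_measure.
  rewrite -Ss -shell0_measure//.
  rewrite (le_trans _ (hausdorff_measureU _ _))// le_hausdorff_measure//.
  move=> x [/andP[x0 xb] etax]; have [xa|ax] := leP (body_dist K x) a.
    by left; split=> //; rewrite x0.
  by right; split=> //; rewrite ax.
have le_a' a' : 0 < a' -> a' < a -> s <= P b - P a'.
  move=> a'0 a'a.
  have sep x y : shell K 0 a' eta x -> shell K a b eta y -> a - a' <= enorm (x - y).
    move=> [/andP[_ xa'] _] [/andP[ay _] _].
    by have := body_dist_lip x y cK; lra.
  have aa' : 0 < a - a' by lra.
  have := hausdorff_measure_separated (ltn0Sn n) aa' sep.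
  rewrite Ss shell0_measure// => le_U.
  have : ((P a')%:E + s%:E <= (P b)%:E)%E.
    rewrite (le_trans le_U)// -shell0_measure// le_hausdorff_measure//.
    by move=> x [|] [/andP[? ?] etax]; split=> //; apply/andP; split; lra.
  by rewrite -EFinD lee_fin; lra.
apply/ler_addgt0Pr => e e0.
(* A Lipschitz constant of [P] on the interval from 0 to [a]. *)
pose D := N%:R * (1 + a) ^+ N * \sum_(i < N) steiner_coef eta i.
have D0 : 0 <= D.
  rewrite mulr_ge0//; last by apply: sumr_ge0 => i _; exact: steiner_coef_ge0.
  by rewrite mulr_ge0// exprn_ge0//; lra.
have Plip a' : 0 <= a' -> a' <= a -> P a - P a' <= D * (a - a').
  move=> a'0 a'a; rewrite /P -sumrB mulrAC mulr_sumr; apply: ler_sum => i _.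
  rewrite -mulrBl ler_wpM2r ?steiner_coef_ge0//.
  have a1 : a <= 1 + a by lra.
  have a2 : 1 <= 1 + a by lra.
  rewrite (le_trans (expr_sub_le _ a'0 a'a a1 a2))// ler_wpM2r//; first by lra.
  apply: ler_pM; [by rewrite ler0n|by rewrite exprn_ge0//; lra|..].
    by rewrite ler_nat leq_subr.
  by rewrite ler_weXn2l// leq_subr.
(* The first bound keeps [a - d] positive, the second gives [D * d <= e] even when [D] vanishes. *)
pose d := Num.min (a / 2) (e / (D + 1)).
have d0 : 0 < d by rewrite lt_min !divr_gt0//; lra.
have [da de] : d <= a / 2 /\ d <= e / (D + 1) by rewrite !ge_min !lexx orbT.
have Dd : D * d <= e.
  move: de; rewrite ler_pdivlMr; last by lra.
  by rewrite mulrDr mulr1; lra.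
have := @le_a' (a - d); have := @Plip (a - d); rewrite subKr; lra.
Qed.

(** Makes thin shells negligible: the bound is linear in the width, uniformly for radii up to 3. *)
Lemma shell_measure_le a b eta : 0 < a -> a < b -> b <= 3 -> measurable eta ->
  (hausdorff_measure (shell K a b eta) <=
   (N%:R * 3 ^+ N * (\sum_(i < N) steiner_coef eta i) * (b - a))%:E)%E.
Proof.
move=> a0 ab b3 meta; rewrite shell_measure// lee_fin mulrAC mulr_sumr.
apply: ler_sum => i _; rewrite ler_wpM2r ?steiner_coef_ge0//.
have b1 : 1 <= 3 :> R by lra.
rewrite (le_trans (expr_sub_le _ (ltW a0) (ltW ab) b3 b1))// ler_wpM2r//; first by lra.
apply: ler_pM; [by rewrite ler0n|by rewrite exprn_ge0|..].
  by rewrite ler_nat leq_subr.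
by rewrite ler_weXn2l// leq_subr.
Qed.

Definition mass_bound (r : R) : R := kappa N / 2 ^+ N * (N%:R * (4 * r)) ^+ N.

(** At radius 1 the Steiner polynomial is the sum of its coefficients, and it measures a shell
    inside the ball. *)
Lemma steiner_mass_le c r : 0 < r -> parallel K 2 `<=` eball c r ->
  \sum_(i < N) steiner_coef setT i <= mass_bound r.
Proof.
move=> r0 Kr; have -> : \sum_(i < N) steiner_coef setT i =
    \sum_(i < N) 1 ^+ (N - i) * steiner_coef setT i.
  by apply: eq_bigr => i _; rewrite expr1n mul1r.
rewrite -lee_fin -shell0_measure//.
apply: (@le_trans _ _ (hausdorff_measure (eball c r))).
  apply: le_hausdorff_measure => x [/andP[_ x1] _]; apply: Kr.
  by apply/parallelE => //; lra.
apply: ge_ereal_sup => _ [d /= d0 <-].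
exact: hausdorff_content_eball.
Qed.

End steiner.

End shells.

(** * Superlevel sets of Lipschitz functions *)

Section layers.
Context {d : measure_display} {T : measurableType d} {R : realType}.
Variables (mu : {finite_measure set T -> \bar R}) (f : T -> R).
Hypotheses (mf : measurable_fun setT f) (f1 : forall x, `|f x| <= 1).

Definition layer t : set T := [set x | t <= f x].

Lemma measurable_layer t : measurable (layer t).
Proof.
have -> : layer t = setT `&` f @^-1` `[t, +oo[.
  by apply/seteqP; split=> [x /= tx|x /= []]; rewrite in_itv/= andbT.
exact: mf.
Qed.

Lemma layer_integrable : mu.-integrable setT (EFin \o f).
Proof.
apply: (le_integrable _ _ _ (finite_measure_integrable_cst mu 1 measurableT)) => //.
  exact/measurable_realfun.measurable_EFinP.
by move=> x _; rewrite /= lee_fin normr1.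
Qed.

(** A staircase of step [w] below [f + 1]; the shift by 1 makes the function nonnegative. *)
Definition layer_sum w m x : R :=
  \sum_(k < m) w * \1_(layer (k.+1%:R * w - 1)) x.

Lemma layer_sum_integral w m :
  mu.-integrable setT (EFin \o layer_sum w m) /\
  (\int[mu]_x layer_sum w m x)%R =
  w * \sum_(k < m) fine (mu (layer (k.+1%:R * w - 1))).
Proof.
elim: m => [|m [IHi IHe]].
  have -> : layer_sum w 0 = cst 0.
    by apply/funext => x; rewrite /layer_sum big_ord0.
  rewrite big_ord0 mulr0 Rintegral_cst// mul0r; split=> //.
  exact: (finite_measure_integrable_cst mu 0 measurableT).
have ml := measurable_layer (m.+1%:R * w - 1).
have ind_int : mu.-integrable setT (EFin \o (\1_(layer (m.+1%:R * w - 1)) : T -> R)).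
  apply: (le_integrable _ _ _ (finite_measure_integrable_cst mu 1 measurableT)) => //.
    exact/measurable_realfun.measurable_EFinP/measurable_realfun.measurable_indic.
  by move=> x _; rewrite /= lee_fin normr1 indicE normr_nat lern1 leq_b1.
have w_int : mu.-integrable setT
    (EFin \o (fun x => w * \1_(layer (m.+1%:R * w - 1)) x)).
  exact: (integrableZl measurableT w ind_int).
have -> : layer_sum w m.+1 =
    (fun x => layer_sum w m x + w * \1_(layer (m.+1%:R * w - 1)) x).
  by apply/funext => x; rewrite /layer_sum big_ord_recr.
split; first exact: (integrableD measurableT IHi w_int).
rewrite RintegralD// IHe RintegralZl// big_ord_recr/= mulrDr; congr (_ + _ * _).
by rewrite /Rintegral integral_indic// setIT.
Qed.

Lemma sum_ltn m p : \sum_(k < m) ((k < p)%N%:R : R) = (minn m p)%:R.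
Proof.
elim: m => [|m IH]; first by rewrite big_ord0 min0n.
rewrite big_ord_recr/= IH; case: ltnP => mp.
  by rewrite (minn_idPl mp) natr1.
by rewrite addr0 (minn_idPr (leqW mp)).
Qed.

(** The point lies in as many layers as there are positive multiples of [w] up to [f x + 1]. As
    [f x <= 1], stopping at the truncation of [2 / w] loses none. *)
Lemma layer_sumE w x : 0 < w ->
  layer_sum w (Num.truncn (2 / w)) x = w * (Num.truncn ((f x + 1) / w))%:R.
Proof.
move=> w0; rewrite /layer_sum -mulr_sumr; congr (_ * _).
have /andP[fx1 fx2] : - 1 <= f x <= 1 by rewrite -ler_norml.
have /minn_idPr minE : (Num.truncn ((f x + 1) / w) <= Num.truncn (2 / w))%N.
  by apply: le_truncn; rewrite ler_pM2r ?invr_gt0//; lra.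
rewrite -minE -sum_ltn; apply: eq_bigr => k _.
rewrite indicE; congr (nat_of_bool _)%:R.
rewrite truncn_gt_nat ler_pdivlMr// -lerBlDr.
by apply/idP/idP => [/set_mem|] //; exact: mem_set.
Qed.

(** Rounding [f + 1] down to a multiple of [w] loses at most [w] pointwise; integrate. *)
Lemma layer_bounds w (S := w * \sum_(k < Num.truncn (2 / w))
    fine (mu (layer (k.+1%:R * w - 1)))) : 0 < w ->
  S <= (\int[mu]_x f x)%R + fine (mu setT) <= S + w * fine (mu setT).
Proof.
move=> w0; have [Hi He] := layer_sum_integral w (Num.truncn (2 / w)).
have int_cst c : mu.-integrable setT (EFin \o cst c).
  exact: (finite_measure_integrable_cst mu c measurableT).
have int1 : (\int[mu]_x (f x + 1))%R = (\int[mu]_x f x)%R + fine (mu setT).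
  by rewrite (RintegralD measurableT layer_integrable (int_cst 1)) Rintegral_cst// mul1r.
have intw : (\int[mu]_x (layer_sum w (Num.truncn (2 / w)) x + w))%R =
    S + w * fine (mu setT).
  by rewrite (RintegralD measurableT Hi (int_cst w)) Rintegral_cst// He.
have int_f1 : mu.-integrable setT (EFin \o (fun x => f x + 1)).
  exact: (integrableD measurableT layer_integrable (int_cst 1)).
rewrite -int1 -intw /S -He; apply/andP; split.
  apply: le_Rintegral => // x _; rewrite layer_sumE//.
  have /andP[fx1 fx2] : - 1 <= f x <= 1 by rewrite -ler_norml.
  have /truncn_itv/andP[le1 _] : 0 <= (f x + 1) / w by rewrite divr_ge0//; lra.
  by rewrite mulrC -ler_pdivlMr.
apply: le_Rintegral => //.
  exact: (integrableD measurableT Hi (int_cst w)).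
move=> x _; rewrite layer_sumE//.
have := truncnS_gt ((f x + 1) / w); rewrite ltr_pdivrMr// -natr1 mulrDl mul1r.
by move=> /ltW; rewrite mulrC.
Qed.

End layers.

Section lipschitz.
Context {R : realType} {n : nat}.
Local Notation N := n.+1.
Implicit Types (z w : SigmaB R n) (f : SigmaB R n -> R).

Lemma sdist_eq0 z w : sdist z w = 0 -> z = w.
Proof.
move=> /eqP; rewrite sqrtr_eq0 => zw; apply: val_inj.
have z0 := sqr_ge0 (enorm ((val z).1 - (val w).1)).
have w0 := sqr_ge0 (enorm ((val z).2 - (val w).2)).
have /eqP : enorm ((val z).1 - (val w).1) ^+ 2 = 0 by lra.
have /eqP : enorm ((val z).2 - (val w).2) ^+ 2 = 0 by lra.
rewrite !sqrf_eq0 => /eqP/enorm_eq0/eqP; rewrite subr_eq0 => /eqP h2.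
move=> /eqP/enorm_eq0/eqP; rewrite subr_eq0 => /eqP h1.
by apply/eqP; rewrite -pair_eqE /= h1 h2 !eqxx.
Qed.

Lemma lip_norm_le1 f z w : (lip_norm f <= 1)%E -> `|f z - f w| <= sdist z w.
Proof.
move=> lf; have [zw|zw] := eqVneq (sdist z w) 0.
  by rewrite (sdist_eq0 zw) subrr normr0 sqrtr_ge0.
have zw0 : 0 < sdist z w by rewrite lt_neqAle eq_sym zw sqrtr_ge0.
rewrite -[leRHS]mul1r -ler_pdivrMr// -lee_fin (le_trans _ lf)//.
apply: ereal_sup_ubound; exists z, w; split=> // zwE.
by move: zw; rewrite zwE /sdist !subrr enorm0 expr0n/= addr0 sqrtr0 eqxx.
Qed.

Lemma sup_norm_le1 f z : (sup_norm f <= 1)%E -> `|f z| <= 1.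
Proof. by move=> sf; rewrite -lee_fin (le_trans _ sf)// ereal_sup_ubound//; exists z. Qed.

Lemma sdist_le z w e : 0 <= e -> enorm ((val z).1 - (val w).1) <= e ->
  enorm ((val z).2 - (val w).2) <= e -> sdist z w <= 2 * e.
Proof.
move=> e0 le1 le2; have e20 : 0 <= 2 * e by rewrite mulr_ge0.
rewrite /sdist -(ger0_norm e20) -sqrtr_sqr ler_wsqrtr// exprMn.
have : enorm ((val z).1 - (val w).1) ^+ 2 <= e ^+ 2.
  by rewrite lerXn2r ?nnegrE ?enorm_ge0.
have : enorm ((val z).2 - (val w).2) ^+ 2 <= e ^+ 2.
  by rewrite lerXn2r ?nnegrE ?enorm_ge0.
have := sqr_ge0 e; lra.
Qed.

Lemma lipschitz_measurable f : (forall z w, `|f z - f w| <= sdist z w) ->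
  measurable_fun setT f.
Proof.
move=> lf; apply: (measurability _ (measurable_realfun.RGenOInfty.measurableE R)) => //.
move=> _ [_ [x ->] <-]; rewrite setTI.
apply: sub_sigma_algebra; rewrite openE => z /=; rewrite in_itv/= andbT => xz.
(* On the sup-norm ball of radius [e], [sdist] is at most [2 * N%:R * e], two thirds of the margin
   [f z - x], so the superlevel set is open. *)
pose e := (f z - x) / (3 * N%:R).
have e0 : 0 < e by rewrite divr_gt0//; lra.
have val_cont : continuous (val : Sigma R n -> 'rV[R]_N * 'rV[R]_N).
  exact: initial_continuous.
have nz : nbhs (z : Sigma R n) ((val : Sigma R n -> _) @^-1` ball (val z) e).
  exact: (val_cont z _ (nbhsx_ballx (val z) _ e0)).
apply: (@filterS _ _ (nbhs_filter (z : Sigma R n)) _ _ _ nz) => w /= [zw1 zw2].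
rewrite in_itv/= andbT.
have N0 : 0 <= N%:R * e by rewrite mulr_ge0// ltW.
have zw : sdist z w <= 2 * (N%:R * e).
  apply: sdist_le => //; apply: (le_trans (enorm_le_norm _)); rewrite ler_wpM2l//.
    by move: zw1; rewrite mx_norm_ball => /ltW.
  by move: zw2; rewrite mx_norm_ball => /ltW.
have Ne : N%:R * e = (f z - x) / 3 by rewrite /e; field; rewrite nat1r pnatr_eq0.
by have := lf z w; rewrite ler_norml => /andP[_]; lra.
Qed.

End lipschitz.

(** * Comparison of two bodies *)

Section comparison.
Context {R : realType} {n : nat}.
Local Notation N := n.+1.
Local Notation family := ('I_N -> {finite_measure set (SigmaB R n) -> \bar R}).
Implicit Types (K L : set 'rV[R]_N) (Lam LamK LamL : family).
Implicit Types (eta : set (SigmaB R n)) (f : SigmaB R n -> R).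

Lemma outer_dir_unit K x : 0 < body_dist K x -> Sigma_set (normal_pair K x).
Proof.
move=> dx; rewrite /Sigma_set /= enormZ gtr0_norm ?invr_gt0//.
by rewrite mulVf// gt_eqF.
Qed.

(** If the distance to [L] leaves the range from 1 to [b], the distance to [K] is within [s ^+ 2] of
    an end of it. Otherwise the normal pair moves by at most [8 * s], and so does [f]. *)
Lemma shell_transfer K L f b s t : convex_body K -> convex_body L ->
  (forall z w, `|f z - f w| <= sdist z w) -> 0 < s -> s < 1 -> 1 < b -> b <= 2 ->
  K `<=` parallel L (s ^+ 2) -> L `<=` parallel K (s ^+ 2) ->
  shell K 1 b (layer f t) `<=` shell L 1 b (layer f (t - 8 * s)) `|`
    (shell K 1 (1 + s ^+ 2) setT `|` shell K (b - s ^+ 2) b setT).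
Proof.
move=> cK cL lf s0 s1 b1 b2 KL LK x [/andP[Kx1 Kxb] [z /= tz zx]].
have zxT : (val @` (setT : set (SigmaB R n))) (normal_pair K x) by exists z.
have d0 := sqr_ge0 s.
have dLK := body_dist_hausdorff cK cL d0 KL x.
have dKL := body_dist_hausdorff cL cK d0 LK x.
have [Lx1|Lx1] := leP (body_dist L x) 1.
  by right; left; split=> //; apply/andP; split; lra.
have [Lxb|Lxb] := ltP b (body_dist L x).
  by right; right; split=> //; apply/andP; split; lra.
left; split; first by rewrite Lx1.
have Lx0 : 0 < body_dist L x by lra.
pose w : SigmaB R n := exist (fun z => z \in @Sigma_set R n) _
  (mem_set (outer_dir_unit Lx0)).
exists w => //=.
(* Both distances are at most 2, so the squared norm is at most [4 * s ^+ 2]. *)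
have proj_s : enorm (metric_proj K x - metric_proj L x) <= 2 * s.
  rewrite -(@ler_pXn2r _ 2)// ?nnegrE ?enorm_ge0//; last by lra.
  rewrite (le_trans (metric_proj_hausdorff cK cL d0 KL LK x))//.
  by rewrite exprMn ler_wpM2r//; lra.
have dir_s := outer_dir_stable (ltW Kx1) (ltW Lx1).
have zw : sdist z w <= 2 * (4 * s).
  by apply: sdist_le; rewrite ?(zx : val z = normal_pair K x) /=; lra.
rewrite /layer /= in tz *.
by have := lf z w; rewrite ler_norml => /andP[_]; lra.
Qed.

Definition level Lam b eta : R :=
  \sum_(i < N) (b ^+ (N - i) - 1) * steiner_coef Lam eta i.

Lemma shell_level K Lam b eta : convex_body K -> support_measures K Lam ->
  1 < b -> measurable eta ->
  hausdorff_measure (shell K 1 b eta) = (level Lam b eta)%:E.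
Proof.
move=> cK sK b1 meta; rewrite (shell_measure cK sK)//.
by congr EFin; apply: eq_bigr => i _; rewrite expr1n.
Qed.

Lemma level_ge0 Lam b eta : 1 <= b -> 0 <= level Lam b eta.
Proof.
move=> b1; apply: sumr_ge0 => i _; rewrite mulr_ge0 ?steiner_coef_ge0//.
by rewrite subr_ge0 exprn_ege1.
Qed.

Lemma level_le Lam b eta : 1 <= b -> b <= 2 -> measurable eta ->
  level Lam b eta <= 2 ^+ N * \sum_(i < N) steiner_coef Lam setT i.
Proof.
move=> b1 b2 meta; rewrite mulr_sumr; apply: ler_sum => i _.
apply: ler_pM; rewrite ?steiner_coef_ge0 ?subr_ge0 ?exprn_ege1//.
  rewrite (@le_trans _ _ (b ^+ (N - i)))//; first by lra.
  rewrite (@le_trans _ _ (2 ^+ (N - i)))//; first by rewrite lerXn2r ?nnegrE; lra.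
  by rewrite ler_weXn2l ?leq_subr//; lra.
rewrite ler_wpM2l ?kappa_ge0// fine_le ?fin_num_measure//.
by rewrite le_measure ?inE.
Qed.

Definition thin_const (V : R) : R := N%:R * 3 ^+ N * V.

Lemma level_transfer K L LamK LamL f V b s t :
  convex_body K -> convex_body L ->
  support_measures K LamK -> support_measures L LamL ->
  \sum_(i < N) steiner_coef LamK setT i <= V ->
  (forall z w, `|f z - f w| <= sdist z w) -> 0 < s -> s < 1 -> 1 < b -> b <= 2 ->
  K `<=` parallel L (s ^+ 2) -> L `<=` parallel K (s ^+ 2) ->
  level LamK b (layer f t) <=
  level LamL b (layer f (t - 8 * s)) + 2 * thin_const V * s ^+ 2.
Proof.
move=> cK cL sK sL KV lf s0 s1 b1 b2 KL LK.
have ml u := measurable_layer (lipschitz_measurable lf) u.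
have s20 : 0 < s ^+ 2 by rewrite exprn_gt0.
have s21 : s ^+ 2 < 1 by rewrite expr2 mulr_ilt1// ltW.
rewrite -lee_fin EFinD -(shell_level cK sK)// -(shell_level cL sL)//.
apply: (le_trans (le_hausdorff_measure (shell_transfer cK cL lf s0 s1 b1 b2 KL LK))).
apply: (le_trans (hausdorff_measureU _ _)); rewrite leeD2l//.
apply: (le_trans (hausdorff_measureU _ _)).
have thin a c : 0 < a -> a < c -> c <= 3 -> c - a = s ^+ 2 ->
    (hausdorff_measure (shell K a c setT) <= (thin_const V * s ^+ 2)%:E)%E.
  move=> a0 ac c3 ca; rewrite (le_trans (shell_measure_le cK sK a0 ac c3 measurableT))//.
  by rewrite lee_fin ca ler_wpM2r ?sqr_ge0// ler_wpM2l.
rewrite -[2]/(1 + 1) 2!mulrDl mul1r EFinD leeD// thin//; lra.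
Qed.

(** The analogue of [level] with integrals of [f] in place of measures of a set. *)
Definition level_int Lam f b : R :=
  \sum_(i < N) (b ^+ (N - i) - 1) * (kappa (N - i) * (\int[Lam i]_z f z)).

Lemma level_int_bounds Lam f b w (S := w * \sum_(k < Num.truncn (2 / w))
    level Lam b (layer f (k.+1%:R * w - 1))) :
  measurable_fun setT f -> (forall z, `|f z| <= 1) -> 1 <= b -> 0 < w ->
  S <= level_int Lam f b + level Lam b setT <= S + w * level Lam b setT.
Proof.
move=> mf f1 b1 w0.
pose Si i := w * \sum_(k < Num.truncn (2 / w))
  fine (Lam i (layer f (k.+1%:R * w - 1))).
have SE : S = \sum_(i < N) ((b ^+ (N - i) - 1) * kappa (N - i)) * Si i.
  rewrite /S /level exchange_big mulr_sumr; apply: eq_bigr => i _ /=.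
  rewrite /Si /steiner_coef; under eq_bigr do rewrite mulrA.
  by rewrite -mulr_sumr; ring.
rewrite SE /level_int /level mulr_sumr -!big_split/=.
have coef_ge0 (i : 'I_N) : 0 <= (b ^+ (N - i) - 1) * kappa (N - i).
  by rewrite mulr_ge0 ?kappa_ge0// subr_ge0 exprn_ege1.
have lb i := layer_bounds (Lam i) mf f1 w0.
apply/andP; split; apply: ler_sum => i _; have /andP[lb1 lb2] := lb i.
  have := ler_wpM2l (coef_ge0 i) lb1; rewrite /steiner_coef /Si; lra.
have := ler_wpM2l (coef_ge0 i) lb2; rewrite /steiner_coef /Si; lra.
Qed.

(** Thin shells cost twice [thin_const V] in comparing total masses and four times in the layer
    sums. Discretisation and index shift cost [8 * s] times the total mass of each body. *)
Definition level_const (V : R) : R := 6 * thin_const V + 16 * (2 ^+ N * V).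

Lemma level_int_transfer K L LamK LamL f V b s :
  convex_body K -> convex_body L ->
  support_measures K LamK -> support_measures L LamL ->
  \sum_(i < N) steiner_coef LamK setT i <= V ->
  \sum_(i < N) steiner_coef LamL setT i <= V ->
  (forall z w, `|f z - f w| <= sdist z w) -> (forall z, `|f z| <= 1) ->
  0 < s -> s < 1 -> 1 < b -> b <= 2 ->
  K `<=` parallel L (s ^+ 2) -> L `<=` parallel K (s ^+ 2) ->
  level_int LamK f b <= level_int LamL f b + level_const V * s.
Proof.
move=> cK cL sK sL KV LV lf f1 s0 s1 b1 b2 KL LK.
have mf := lipschitz_measurable lf.
have ml u := measurable_layer mf u.
have w0 : 0 < 8 * s by lra.
set w := 8 * s in w0.
have /andP[_ K2] := level_int_bounds LamK mf f1 (ltW b1) w0.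
have /andP[L1 _] := level_int_bounds LamL mf f1 (ltW b1) w0.
set m := Num.truncn _ in K2 L1.
set TK := level LamK b setT in K2 *; set TL := level LamL b setT in L1 *.
set D := thin_const V * s ^+ 2.
have layerT u : u <= - 1 -> layer f u = setT.
  move=> u1; apply/seteqP; split=> // z _; rewrite /layer /=.
  by have := f1 z; rewrite ler_norml => /andP[]; lra.
(* At level -1 both layers are the whole space. *)
have TLK : TL <= TK + 2 * D.
  have := level_transfer (-1) cL cK sL sK LV lf s0 s1 b1 b2 LK KL.
  rewrite layerT// layerT; last by lra.
  by rewrite -/TK -/TL /D; lra.
have V0 : 0 <= V.
  by rewrite (le_trans _ KV)// sumr_ge0// => i _; exact: steiner_coef_ge0.
have pow0 : 0 <= 2 ^+ N :> R by rewrite exprn_ge0.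
have TV Lam : \sum_(i < N) steiner_coef Lam setT i <= V ->
    level Lam b setT <= 2 ^+ N * V.
  by move=> le_V; rewrite (le_trans (level_le _ (ltW b1) b2 measurableT))// ler_wpM2l.
have TKV := TV _ KV; have TLV := TV _ LV.
rewrite -/TK in TKV; rewrite -/TL in TLV.
have mw : w * m%:R <= 2.
  have /truncn_itv/andP[le_m _] : 0 <= 2 / w by rewrite divr_ge0// ltW.
  by rewrite mulrC -ler_pdivlMr.
(* The spacing [w] equals the shift [8 * s], so the shifted levels are the same grid moved by one
   index. Only the bottom term [TL] is new. *)
have SKL : \sum_(k < m) level LamK b (layer f (k.+1%:R * w - 1)) <=
    TL + \sum_(k < m) level LamL b (layer f (k.+1%:R * w - 1)) + m%:R * (2 * D).
  have -> : m%:R * (2 * D) = \sum_(k < m) 2 * D.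
    by rewrite sumr_const card_ord mulr_natl.
  rewrite (@le_trans _ _ (\sum_(k < m)
      (level LamL b (layer f (k%:R * w - 1)) + 2 * D)))//.
    apply: ler_sum => k _.
    have := level_transfer (k.+1%:R * w - 1) cK cL sK sL KV lf s0 s1 b1 b2 KL LK.
    have -> : k.+1%:R * w - 1 - 8 * s = k%:R * w - 1 by rewrite -natr1 /w; ring.
    by rewrite /D; lra.
  rewrite big_split/= lerD2r.
  pose F k := level LamL b (layer f (k%:R * w - 1)).
  have F0 : F 0%N = TL by rewrite /F mul0r add0r layerT.
  have Fm : 0 <= F m by exact/level_ge0/ltW.
  have sumE : \sum_(k < m) F k + F m = F 0%N + \sum_(k < m) F k.+1.
    transitivity (\sum_(k < m.+1) F k); first by rewrite big_ord_recr.
    by rewrite big_ord_recl.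
  by rewrite F0 /F in sumE; rewrite /F in Fm; lra.
have D0 : 0 <= D by rewrite /D mulr_ge0 ?sqr_ge0// /thin_const !mulr_ge0// exprn_ge0.
have wS := ler_wpM2l (ltW w0) SKL.
have wmD : w * (m%:R * (2 * D)) <= 2 * (2 * D).
  by rewrite [leLHS]mulrA ler_wpM2r// mulr_ge0.
have wTK : w * TK <= w * (2 ^+ N * V) by rewrite ler_wpM2l// ltW.
have wTL : w * TL <= w * (2 ^+ N * V) by rewrite ler_wpM2l// ltW.
have Ds : D <= thin_const V * s.
  rewrite ler_wpM2l//; first by rewrite /thin_const !mulr_ge0// exprn_ge0.
  by rewrite expr2 ler_piMl ?ltW.
have wE : w * (2 ^+ N * V) = 8 * (2 ^+ N * V * s) by rewrite /w; ring.
have -> : level_const V * s = 6 * (thin_const V * s) + 16 * (2 ^+ N * V * s).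
  by rewrite /level_const; ring.
rewrite !mulrDr in wS; lra.
Qed.

End comparison.

(** * Interpolation in the radius *)

Section interpolation.
Context {R : realType} {n : nat}.
Local Notation N := n.+1.

(** Equally spaced radii from 1 to 2. *)
Definition node (j : 'I_N.+1) : R := 1 + j%:R / N%:R.

Lemma node_inj : injective node.
Proof.
move=> i j /addrI /mulIf ij; apply/val_inj/eqP; rewrite -(eqr_nat R).
by apply/eqP/ij; rewrite invr_eq0 pnatr_eq0.
Qed.

Lemma node_gt1 (j : 'I_N.+1) : (0 < j)%N -> 1 < node j.
Proof. by move=> j0; rewrite ltrDl divr_gt0// ltr0n. Qed.

Lemma node_le2 j : node j <= 2.
Proof.
rewrite /node -[2]/(1 + 1) lerD2l ler_pdivrMr ?ltr0n// mul1r ler_nat.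
by rewrite -ltnS ltn_ord.
Qed.

(* A polynomial of degree at most [N] is recovered from its values at the [N + 1]
   nodes; its constant coefficient [- \sum_i D i] makes it vanish at [1]. *)
Lemma interpolation_bound : exists2 B : R, 0 <= B & forall (D : 'I_N -> R) (e : R),
  (forall j, `|\sum_(i < N) (node j ^+ (N - i) - 1) * D i| <= e) ->
  forall i, `|D i| <= B * e.
Proof.
pose a : 'rV[R]_N.+1 := \row_j node j.
pose V := Vandermonde N.+1 a.
have Vunit : V \in unitmx.
  rewrite unitmxE det_Vandermonde unitfE; apply/prodf_neq0 => i _.
  apply/prodf_neq0 => j ij; rewrite !mxE subr_eq0.
  by apply: contraTneq ij => /node_inj ->; rewrite ltnn.
exists (\sum_j \sum_k `|invmx V j k|).
  by apply: sumr_ge0 => j _; apply: sumr_ge0 => k _.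
move=> D e De i.
(* Coefficients by increasing degree: [D i] belongs to degree [N - i], hence the reversal of
   indices. *)
pose c : 'rV[R]_N.+1 := \row_k
  if unlift ord0 k is Some k' then D (rev_ord k') else - \sum_(i < N) D i.
have cV j : (c *m V) ord0 j = \sum_(i < N) (node j ^+ (N - i) - 1) * D i.
  rewrite mxE big_ord_recl.
  have -> : c ord0 ord0 * V ord0 j = - \sum_(i < N) D i.
    by rewrite !mxE unlift_none expr0 mulr1.
  have -> : \sum_k c ord0 (lift ord0 k) * V (lift ord0 k) j =
      \sum_(k < N) D (rev_ord k) * node j ^+ k.+1.
    by apply: eq_bigr => k _; rewrite !mxE liftK.
  rewrite [X in _ + X](reindex_inj rev_ord_inj) -sumrN -big_split.
  apply: eq_bigr => k _; rewrite rev_ordK.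
  rewrite [(rev_ord k).+1]subnSK//.
  by rewrite mulrBl mul1r addrC mulrC.
have -> : D i = c ord0 (lift ord0 (rev_ord i)) by rewrite mxE liftK rev_ordK.
have yE : c = (c *m V) *m invmx V by rewrite mulmxK.
have {}De j : `|(c *m V) ord0 j| <= e by rewrite cV.
move: (c *m V) yE De => y -> De; rewrite {cV}.
clearbody V; rewrite mxE (le_trans (ler_norm_sum _ _ _))//.
rewrite mulr_suml; apply: ler_sum => j _.
rewrite normrM mulrC ler_pM// (bigD1 (lift ord0 (rev_ord i)))//= lerDl.
exact: sumr_ge0.
Qed.

End interpolation.

(** * Proof of the estimate *)

Section hoelder.
Context {R : realType} {n : nat}.
Local Notation N := n.+1.
Local Notation family := ('I_N -> {finite_measure set (SigmaB R n) -> \bar R}).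
Implicit Types (K L : set 'rV[R]_N) (Lam LamK LamL : family).
Implicit Types (f : SigmaB R n -> R).

Lemma integral_kappa_le Lam f V (i : 'I_N) : \sum_(i < N) steiner_coef Lam setT i <= V ->
  measurable_fun setT f -> (forall z, `|f z| <= 1) ->
  kappa (N - i) * `|(\int[Lam i]_z f z)%R| <= V.
Proof.
move=> LV mf f1; apply: (@le_trans _ _ (steiner_coef Lam setT i)).
  rewrite ler_wpM2l ?kappa_ge0//.
  have if1 := layer_integrable (Lam i) mf f1.
  rewrite (le_trans (le_normr_Rintegral measurableT if1))//.
  rewrite -[leRHS]mul1r -Rintegral_cst//; apply: le_Rintegral => //.
    exact: (integrable_norm if1).
  exact: (finite_measure_integrable_cst (Lam i) 1 measurableT).
rewrite (le_trans _ LV)// (bigD1 i)//= lerDl.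
by apply: sumr_ge0 => j _; exact: steiner_coef_ge0.
Qed.

(** [level_int_transfer], applied in both directions, bounds the difference of the [level_int] at
    every node; interpolation then isolates each degree. *)
Lemma integral_close V : 0 <= V -> exists2 C : R, 0 <= C &
  forall K L LamK LamL f s, convex_body K -> convex_body L ->
  support_measures K LamK -> support_measures L LamL ->
  \sum_(i < N) steiner_coef LamK setT i <= V ->
  \sum_(i < N) steiner_coef LamL setT i <= V ->
  (forall z w, `|f z - f w| <= sdist z w) -> (forall z, `|f z| <= 1) -> 0 < s ->
  K `<=` parallel L (s ^+ 2) -> L `<=` parallel K (s ^+ 2) ->
  forall i, `|(\int[LamK i]_z f z)%R - (\int[LamL i]_z f z)%R| <= C * s.
Proof.
move=> V0; have [B B0 HB] := @interpolation_bound R n.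
(* A bound for all inverse [kappa] at once, so that the constant is independent of [i]. *)
pose kinv : R := \sum_(i < N) (kappa (N - i))^-1.
have kinv_ge (i : 'I_N) : (kappa (N - i))^-1 <= kinv.
  rewrite /kinv (bigD1 i)//= lerDl.
  by apply: sumr_ge0 => j _; rewrite invr_ge0 kappa_ge0.
have kinv0 : 0 <= kinv by apply: sumr_ge0 => j _; rewrite invr_ge0 kappa_ge0.
pose E := @level_const R n V.
have E0 : 0 <= E.
  by rewrite addr_ge0 ?mulr_ge0// ?exprn_ge0// /thin_const !mulr_ge0// exprn_ge0.
exists (kinv * (B * E + 2 * V)); first by rewrite mulr_ge0// addr_ge0// mulr_ge0.
move=> K L LamK LamL f s cK cL sK sL KV LV lf f1 s0 KL LK i.
have mf := lipschitz_measurable lf.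
pose D (i : 'I_N) := kappa (N - i) * ((\int[LamK i]_z f z)%R - (\int[LamL i]_z f z)%R).
have -> : (\int[LamK i]_z f z)%R - (\int[LamL i]_z f z)%R =
    (kappa (N - i))^-1 * D i.
  by rewrite /D mulKf// gt_eqF// kappa_gt0.
rewrite normrM ger0_norm ?invr_ge0 ?kappa_ge0// -mulrA.
apply: ler_pM => //; first by rewrite invr_ge0 kappa_ge0.
(* For [s >= 1] the total masses alone give [2 * V <= 2 * V * s]. *)
rewrite mulrDl; have [s1|s1] := ltP s 1; last first.
  rewrite (@le_trans _ _ (2 * V))//; last first.
    rewrite (@le_trans _ _ (2 * V * s))// ?ler_peMr ?mulr_ge0// lerDr.
    by rewrite !mulr_ge0// ltW.
  rewrite /D mulrBr (le_trans (ler_normB _ _))// !normrM.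
  rewrite !(ger0_norm (kappa_ge0 _)).
  have := integral_kappa_le i KV mf f1; have := integral_kappa_le i LV mf f1; lra.
apply: (@le_trans _ _ (B * (E * s))); last by rewrite mulrA lerDl !mulr_ge0// ltW.
apply: HB => j.
(* The first node is 1, where the shell is empty and the combination vanishes identically. *)
have [j0|j0] := posnP j.
  have nj : node j = 1 :> R by rewrite /node j0 mul0r addr0.
  rewrite big1 ?normr0 ?mulr_ge0// ?ltW// => k _.
  by rewrite nj expr1n subrr mul0r.
have -> : \sum_(i < N) (node j ^+ (N - i) - 1) * D i =
    level_int LamK f (node j) - level_int LamL f (node j).
  by rewrite -sumrB; apply: eq_bigr => k _; rewrite /D !mulrBr.
have b1 := @node_gt1 R n j j0; have b2 := @node_le2 R n j.
have := level_int_transfer cK cL sK sL KV LV lf f1 s0 s1 b1 b2 KL LK.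
have := level_int_transfer cL cK sL sK LV KV lf f1 s0 s1 b1 b2 LK KL.
rewrite -/E ler_norml => ? ?; apply/andP; split; lra.
Qed.

End hoelder.

(** * The Hausdorff distance of two bodies in a common ball *)

Section hausdorff_distance.
Context {R : realType} {n : nat}.
Implicit Types (K L : set 'rV[R]_n).

Lemma le_parallel K (a b : R) : convex_body K -> 0 <= a -> a <= b -> 0 < b ->
  parallel K a `<=` parallel K b.
Proof.
move=> cK a0 ab b0 x /(parallel_body_dist cK a0) dx.
by apply: body_dist_parallel => //; exact: le_trans ab.
Qed.

Lemma sub_parallel K (a : R) : convex_body K -> 0 < a -> K `<=` parallel K a.
Proof.
by move=> cK a0 x Kx; apply: body_dist_parallel; rewrite ?(body_dist_in cK Kx)// ltW.
Qed.

Section bounded.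
Variables (K L : set 'rV[R]_n) (c : 'rV[R]_n) (r : R).
Hypotheses (cK : convex_body K) (cL : convex_body L) (r0 : 0 < r).
Hypotheses (Kr : K `<=` eball c r) (Lr : L `<=` eball c r).

Let near_bodies : set R :=
  [set rho | [/\ 0 <= rho, K `<=` parallel L rho & L `<=` parallel K rho]].

Let near_bodies_lb : lbound near_bodies 0. Proof. by move=> rho []. Qed.

(** Two points of the ball are at distance at most [2 * r], so this radius is admissible. *)
Let near_bodies_has_inf : has_inf near_bodies.
Proof.
split; last by exists 0.
have sub M M' : convex_body M' -> M `<=` eball c r -> M' `<=` eball c r ->
    M `<=` parallel M' (2 * r).
  move=> cM' Mr M'r x /Mr xr; apply: body_dist_parallel; rewrite ?mulr_gt0//.
  have [y M'y] : M' !=set0 by case: cM'.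
  have yr := M'r _ M'y.
  rewrite (le_trans (body_dist_le cM' M'y))//.
  rewrite (le_trans (enorm_triangle c _ _))// mulrDl mul1r lerD//.
  by rewrite enormC.
by exists (2 * r); split; [rewrite mulr_ge0// ltW | exact: sub | exact: sub].
Qed.

Lemma hausdorff_dist_ge0 : 0 <= hausdorff_dist K L.
Proof. by apply: lb_le_inf => //; case: near_bodies_has_inf. Qed.

(** Working with radii strictly above the distance avoids showing that the infimum is attained. *)
Lemma hausdorff_dist_lt rho : hausdorff_dist K L < rho ->
  K `<=` parallel L rho /\ L `<=` parallel K rho.
Proof.
move=> hrho; have e0 : 0 < rho - hausdorff_dist K L by rewrite subr_gt0.
have [d [d0 KL LK]] := inf_adherent e0 near_bodies_has_inf.
rewrite -/(hausdorff_dist K L) addrC subrK => drho.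
have rho0 : 0 < rho := le_lt_trans d0 drho.
by split; apply: subset_trans (le_parallel _ d0 (ltW drho) rho0).
Qed.

End bounded.

End hausdorff_distance.

Unset Implicit Arguments.

(* The dimension is n.+1. *)
Theorem theorem1p1 (R : realType) (n : nat) (r : R) (r_gt0 : 0 < r) :
  exists C : R,
    forall (K L : set 'rV[R]_n.+1)
      (LamK LamL : 'I_n.+1 -> {finite_measure set (SigmaB R n) -> \bar R}),
      convex_body K -> convex_body L ->
      (exists c : 'rV[R]_n.+1,
         parallel K 2 `<=` eball c r /\ parallel L 2 `<=` eball c r) ->
      support_measures K LamK -> support_measures L LamL ->
      forall i : 'I_n.+1,
        (dbL (LamK i) (LamL i) <= (C * Num.sqrt (hausdorff_dist K L))%:E)%E.
Proof.
have V0 : 0 <= @mass_bound R n r.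
  rewrite mulr_ge0//; first by rewrite divr_ge0 ?kappa_ge0// exprn_ge0.
  by rewrite exprn_ge0// !mulr_ge0// ltW.
have [C C0 HC] := integral_close (n := n) V0.
exists C => K L LamK LamL cK cL [c [Kr Lr]] sK sL i.
have K2r := subset_trans (sub_parallel cK (ltr0Sn R 1)) Kr.
have L2r := subset_trans (sub_parallel cL (ltr0Sn R 1)) Lr.
have KV := steiner_mass_le cK sK r_gt0 Kr.
have LV := steiner_mass_le cL sL r_gt0 Lr.
set h := hausdorff_dist K L.
have h0 : 0 <= h := hausdorff_dist_ge0 cK cL r_gt0 K2r L2r.
apply: ge_ereal_sup => _ [f [lf sf] <-]; rewrite lee_fin.
apply/ler_addgt0Pr => e e0.
(* The excess makes [s] positive and [s ^+ 2] strictly larger than [h], also when [h = 0]; it costs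
   at most [e] after multiplication by [C]. *)
pose s := Num.sqrt h + e / (C + 1).
have e1 : 0 < e / (C + 1) by rewrite divr_gt0//; lra.
have s0 : 0 < s by rewrite ltr_wpDl// sqrtr_ge0.
have hs : h < s ^+ 2.
  by rewrite -[h]sqr_sqrtr// ltrXn2r// ?nnegrE ?sqrtr_ge0// ?ltW// ltrDl.
have [KL LK] := hausdorff_dist_lt cK cL r_gt0 K2r L2r hs.
have lip z w := @lip_norm_le1 R n f z w lf.
have bnd z := @sup_norm_le1 R n f z sf.
rewrite (le_trans (HC K L LamK LamL f s cK cL sK sL KV LV lip bnd s0 KL LK i))//.
rewrite /s mulrDr lerD2l mulrA ler_pdivrMr; last by lra.
by rewrite mulrC ler_wpM2l//; lra.
Qed.
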